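(* Let $1<p<\infty$ and let $f\in L^p$ be a first-order Haar chaos such that both $\hat f$ and $1/\hat f$ belong to $M_p^+(\mathbb D_{2^{-1/p}})$. Let $\{d_k\}_{k\ge0}$ be the Taylor coefficients of $1/\hat f$ and, for $n\ge1$, let $m=\lfloor\log_2 n\rfloor$, let $\nu(n)$ be the largest integer with $2^{\nu(n)}\mid n$, and set $g^n=\sum_{j=0}^{\nu(n)}d_j2^{m-j}h_{n/2^j}$. Then the system of dilations and translations of $f$ is a basis in chaoses in $L^p$: for every mean-zero $x\in L^p$ and every $d\ge1$ the series $\sum_{n\in N_d}(x,g^n)f_n$ converges in $L^p$ to some $x_d$, and $x=\sum_{d=1}^\infty x_d$ with convergence in $L^p$.
   Context: All functions are complex-valued on $I=(0,1]$; $(u,v)=\int_0^1u(t)v(t)\,dt$. Let $h=\chi_{(0,1/2]}-\chi_{(1/2,1]}$. For $n=2^k+j$ with $k\ge0$, $0\le j\le 2^k-1$, $h_n(t)=h(2^kt-j)$ for $t\in(j2^{-k},(j+1)2^{-k}]$ and $0$ otherwise. For mean-zero $f\in L^1$, the system of dilations and translations is $f_n(t)=f(2^kt-j)$ on $(j2^{-k},(j+1)2^{-k}]$, $0$ otherwise. A first-order Haar chaos is a function $f=\sum_{k\ge0}c_kh_{2^k}$, $c_k\in\mathbb C$; its symbol is $\hat f(z)=\sum_kc_kz^k$. $N_d$ is the set of positive integers with exactly $d$ ones in their binary expansion. For $1\le p\le\infty$, $R>0$, $A_p^+(\mathbb D_R)$ is the Banach space of analytic $u(z)=\sum_ka_kz^k$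 in $\mathbb D_R=\{|z|<R\}$ with $\|u\|=\|(a_kR^k)_k\|_{\ell^p}<\infty$; $M_p^+(\mathbb D_R)$ is the Banach algebra of $u\in A_p^+(\mathbb D_R)$ with $uv\in A_p^+(\mathbb D_R)$ for every $v\in A_p^+(\mathbb D_R)$. *)

(* Defs.v *)
From HB Require Import structures.
From mathcomp Require Import all_boot all_order all_algebra.
From mathcomp Require Import all_classical all_reals all_analysis.
From mathcomp Require Import complex.
Set Implicit Arguments. Unset Strict Implicit. Unset Printing Implicit Defensive.
Import Order.TTheory GRing.Theory Num.Theory.
Import numFieldNormedType.Exports.
Local Open Scope classical_set_scope.
Local Open Scope ring_scope.
Local Open Scope complex_scope.

Section Defs.
Variable R : realType.
Local Notation C := (R[i]).
Local Notation mu := (@lebesgue_measure R).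
Local Notation I := (`]0%R, 1%R]%classic : set R).

Definition cre (z : C) : R := let: a +i* _ := z in a.
Definition cim (z : C) : R := let: _ +i* b := z in b.
Definition cabs (z : C) : R := Num.sqrt (cre z ^+ 2 + cim z ^+ 2).

Definition haar0 (t : R) : R :=
  if (0 < t) && (t <= 2^-1) then 1 else if (2^-1 < t) && (t <= 1) then -1 else 0.

Definition hlev (n : nat) : nat := trunc_log 2 n.
Definition hshift (n : nat) : nat := (n - 2 ^ hlev n)%N.

Definition dil (f : R -> C) (n : nat) (t : R) : C :=
  if ((hshift n)%:R / (2 ^+ hlev n) < t) && (t <= (hshift n).+1%:R / (2 ^+ hlev n))
  then f ((2 ^+ hlev n) * t - (hshift n)%:R) else 0.

Definition haar (n : nat) : R -> C := dil (fun t => (haar0 t)%:C%C) n.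

(* number of ones in the binary expansion of n ; N_d = {n >= 1 | bitcount n = d} *)
Definition bitcount (n : nat) : nat := (\sum_(i < n.+1) odd (n %/ 2 ^ i))%N.

Definition cint (u : R -> C) : C :=
  (Rintegral mu I (fun t => cre (u t)) +i* Rintegral mu I (fun t => cim (u t)))%C.

Definition pairing (u v : R -> C) : C := cint (fun t => u t * v t).

Definition cmeasurable (u : R -> C) : Prop :=
  measurable_fun I (fun t => cre (u t)) /\ measurable_fun I (fun t => cim (u t)).

Definition Lpint (p : R) (u : R -> C) : \bar R :=
  (\int[mu]_(t in I) ((cabs (u t)) `^ p)%:E)%E.

Definition inLp (p : R) (u : R -> C) : Prop :=
  cmeasurable u /\ (Lpint p u < +oo)%E.

Definition Lp_cvg (p : R) (s : nat -> R -> C) (x : R -> C) : Prop :=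
  (fun N => Lpint p (fun t => s N t - x t)) @ \oo --> 0%E.

(* A_p^+(D_rho), 1 <= p < oo, described by the Taylor coefficients a *)
Definition Ap (p rho : R) (a : nat -> C) : Prop :=
  (\sum_(0 <= k <oo) ((cabs (a k) * rho ^+ k) `^ p)%:E < +oo)%E.

Definition cauchy_prod (a b : nat -> C) (n : nat) : C :=
  \sum_(i < n.+1) a i * b (n - i)%N.

Definition Mp (p rho : R) (a : nat -> C) : Prop :=
  Ap p rho a /\ forall b, Ap p rho b -> Ap p rho (cauchy_prod a b).

Definition gfun (d : nat -> C) (n : nat) (t : R) : C :=
  \sum_(j < (logn 2 n).+1) d j * (2 ^ (hlev n - j))%:R * haar (n %/ 2 ^ j) t.

End Defs.

(* Main.v *)
(* Number the dyadic subintervals of (0, 1] like the Haar functions, the halves of node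
   n being the nodes 2n and 2n+1, and let cell n be node 2n+1.  For each D the cells of
   the n with D binary ones partition (0, 1], so a chaos of order D is a function of the
   index of the cell containing t, and its L^p norm is a weighted l^p norm.  Along the
   chain q, 2q, 4q, ... of an odd q, summing the dilations of f is convolution with the
   values s * c of f on the cells 2^i, where s has symbol (2 z - 1) / (1 - z), and pairing
   with the g^n is convolution of the Haar coefficients of x with d.  The multiplier
   hypotheses make these convolutions bounded, and since c * d = 1 the D-th component of x
   is s * (Haar coefficients of x), which telescopes to the difference of the averages of
   x over the cells of orders D and D-1.  Hence the partial sums over D are averages of x
   over intervals shrinking to t; they converge to x almost everywhere by Lebesgue's
   differentiation theorem, and in L^p by Jensen's inequality and Fatou's lemma. *)
From Pilot Require Import Defs.
From HB Require Import structures.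
From mathcomp Require Import all_boot all_order all_algebra.
From mathcomp Require Import all_classical all_reals all_analysis.
From mathcomp Require Import measurable_realfun complex.
From mathcomp Require Import ring lra zify.
Import Order.TTheory GRing.Theory Num.Theory.
Import numFieldNormedType.Exports.
Import Pilot.Defs.
Local Open Scope classical_set_scope.
Local Open Scope ring_scope.
Local Open Scope complex_scope.

(** * The modulus of a complex number and its p-th power *)

Section ComplexPower.
Context {R : realType}.
Implicit Types (z w : R[i]) (p : R).

(** Membership in M_p^+ only says that products stay in the space, whereas summing over infinitely
    many chains needs one constant valid for all of them; [Mp_bounded] extracts it. The radius
    2^(-1/p) fits because its p-th power 1/2 is the ratio of the measures of consecutive nodes of a
    chain, so the norm of A_p^+ along a chain is an L^p norm up to a factor. The second obstacle is
    that the nodes q, 2q, 4q, ... are nested: Jensen's inequality alone would count the mass of x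
    near their common left endpoint once for each node. The Haar coefficients are still p-summable
    with these weights, because for p > 1 the relation 2 s_i = s_(i+1) + b_i is a contraction
    ([halving_bounded]). Inside one chaos, a partial sum over n < N is the same bounded operator
    applied to truncated coefficients, so its error is governed by the tail of a convergent series.
    Summation over D involves no property of f: the components x_D do not depend on f. *)

Lemma cabsE z : cabs z = ComplexField.Normc.normc z.
Proof. by case: z. Qed.

Lemma cabs_ge0 z : 0 <= cabs z.
Proof. exact: sqrtr_ge0. Qed.

Lemma cabs0 : cabs (0 : R[i]) = 0.
Proof. by rewrite cabsE ComplexField.Normc.normc0. Qed.

Lemma cabsM z w : cabs (z * w) = cabs z * cabs w.
Proof. by rewrite !cabsE ComplexField.Normc.normcM. Qed.

Lemma cabsN z : cabs (- z) = cabs z.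
Proof. by case: z => a b; rewrite /cabs /= !sqrrN. Qed.

Lemma cabs_addr_le z w : cabs (z + w) <= cabs z + cabs w.
Proof. by rewrite !cabsE le_normcD. Qed.

Lemma cabs_re z : `|cre z| <= cabs z.
Proof.
by case: z => a b; rewrite /cabs /= -sqrtr_sqr ler_wsqrtr // lerDl sqr_ge0.
Qed.

Lemma cabs_im z : `|cim z| <= cabs z.
Proof.
by case: z => a b; rewrite /cabs /= -sqrtr_sqr ler_wsqrtr // lerDr sqr_ge0.
Qed.

Definition cpow p z : R := cabs z `^ p.

Lemma cpow_ge0 p z : 0 <= cpow p z.
Proof. exact: powR_ge0. Qed.

Lemma cpow0 p : 0 < p -> cpow p 0 = 0.
Proof. by move=> p0; rewrite /cpow cabs0 powR0// gt_eqF. Qed.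

Lemma cpowM p z w : cpow p (z * w) = cpow p z * cpow p w.
Proof. by rewrite /cpow cabsM powRM // cabs_ge0. Qed.

Lemma cpowN p z : cpow p (- z) = cpow p z.
Proof. by rewrite /cpow cabsN. Qed.

(** The coefficient of u^p can be as close to 1 as desired, which leaves room for the contractions
    below. With e = k^(1/p) - 1, either v <= e u and then u + v <= k^(1/p) u, or u < v/e and then u
    + v <= (1 + 1/e) v. *)
Lemma powR_add_le p (k : R) : 0 < p -> 1 < k ->
  exists2 K : R, 0 <= K &
    forall u v : R, 0 <= u -> 0 <= v -> (u + v) `^ p <= k * u `^ p + K * v `^ p.
Proof.
move=> p0 k1.
have k0 : 0 < k by exact: lt_trans k1.
have D1 : 1 < k `^ p^-1.
  have -> : 1 = 1 `^ p^-1 :> R by rewrite powR1.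
  by rewrite gt0_ltr_powR ?invr_gt0 ?nnegrE // ltW.
set D := k `^ p^-1 in D1.
pose e := D - 1.
have e0 : 0 < e by rewrite subr_gt0.
exists ((1 + e^-1) `^ p); first exact: powR_ge0.
move=> u v u0 v0; have [vu|uv] := leP v (e * u).
  apply: (@le_trans _ _ (k * u `^ p)); last by rewrite lerDl mulr_ge0 ?powR_ge0.
  have -> : k = D `^ p by rewrite -powRrM mulVf ?gt_eqF // powRr1 ?ltW.
  rewrite -powRM //; last by rewrite ltW // (lt_trans _ D1).
  rewrite ge0_ler_powR ?nnegrE ?addr_ge0 //; first exact: ltW.
    by rewrite mulr_ge0 // ltW // (lt_trans _ D1).
  by rewrite (le_trans (lerD (lexx u) vu)) // /e; lra.
apply: (@le_trans _ _ ((1 + e^-1) `^ p * v `^ p)).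
  rewrite -powRM ?addr_ge0 ?invr_ge0 ?(ltW e0) //.
  rewrite ge0_ler_powR ?nnegrE ?addr_ge0 ?mulr_ge0 ?addr_ge0 ?invr_ge0 //; try exact: ltW.
  rewrite mulrDl mul1r addrC lerD2l ltW //.
  by rewrite mulrC ltr_pdivlMr // mulrC.
by rewrite lerDr mulr_ge0 ?powR_ge0 // ltW.
Qed.

Lemma cpow_add_le p (k : R) : 0 < p -> 1 < k ->
  exists2 K : R, 0 <= K &
    forall z w, cpow p (z + w) <= k * cpow p z + K * cpow p w.
Proof.
move=> p0 k1; have [K K0 HK] := powR_add_le p k p0 k1.
exists K => // z w; apply: le_trans (HK _ _ (cabs_ge0 z) (cabs_ge0 w)).
by rewrite /cpow ge0_ler_powR ?nnegrE ?cabs_ge0 ?addr_ge0 ?cabs_ge0 ?cabs_addr_le // ltW.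
Qed.

Lemma powR2_add_le p (u v : R) : 0 < p -> 0 <= u -> 0 <= v ->
  (u + v) `^ p <= 2 `^ p * (u `^ p + v `^ p).
Proof.
move=> p0; wlog uv : u v / u <= v => [H u0 v0|u0 v0].
  have [uv|/ltW vu] := leP u v; first exact: H.
  by rewrite addrC [_ `^ p + _]addrC H.
rewrite mulrDr -!powRM // (@le_trans _ _ ((2 * v) `^ p)) //.
  by rewrite ge0_ler_powR ?nnegrE ?addr_ge0 ?mulr_ge0 ?(ltW p0) //; lra.
by rewrite lerDr powR_ge0.
Qed.

Lemma cpow2_add_le p z w : 0 < p ->
  cpow p (z + w) <= 2 `^ p * (cpow p z + cpow p w).
Proof.
move=> p0; apply: le_trans (powR2_add_le p _ _ p0 (cabs_ge0 z) (cabs_ge0 w)).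
by rewrite /cpow ge0_ler_powR ?nnegrE ?cabs_ge0 ?addr_ge0 ?cabs_ge0 ?cabs_addr_le // ltW.
Qed.

End ComplexPower.

(** * Weighted l^p sums: boundedness of multipliers and Hardy-type inequalities *)

Section WeightedSums.
Context {R : realType}.
Implicit Types (a b s u : nat -> R[i]) (p : R) (N : nat).

(** The p-th power of the norm of A_p^+ at radius 2^(-1/p), truncated so that it is always a finite
    real number. *)
Definition wsum p b N : R := \sum_(k < N) 2^-1 ^+ k * cpow p (b k).

Lemma wterm_ge0 p b k : 0 <= 2^-1 ^+ k * cpow p (b k).
Proof. by rewrite mulr_ge0 ?cpow_ge0 ?exprn_ge0 // invr_ge0. Qed.

Lemma wsum_ge0 p b N : 0 <= wsum p b N.
Proof. by apply: sumr_ge0 => k _; exact: wterm_ge0. Qed.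

Lemma wsumS p b N : wsum p b N.+1 = wsum p b N + 2^-1 ^+ N * cpow p (b N).
Proof. by rewrite /wsum big_ord_recr. Qed.

Lemma wsumD p b M N :
  wsum p b (M + N) = wsum p b M + 2^-1 ^+ M * wsum p (fun k => b (M + k)%N) N.
Proof.
rewrite /wsum big_split_ord /= mulr_sumr; congr (_ + _).
by apply: eq_bigr => k _; rewrite exprD mulrA.
Qed.

Lemma wsum_mono p b : {homo wsum p b : M N / (M <= N)%N >-> M <= N}.
Proof.
move=> M N MN; rewrite -(subnKC MN) wsumD lerDl.
by rewrite mulr_ge0 ?wsum_ge0 // exprn_ge0 // invr_ge0.
Qed.

Lemma eq_wsum p b b' N :
  (forall k, (k < N)%N -> b k = b' k) -> wsum p b N = wsum p b' N.
Proof. by move=> bb'; apply: eq_bigr => k _; rewrite bb'. Qed.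

Lemma wsumZ p (l : R[i]) b N : wsum p (fun k => l * b k) N = cpow p l * wsum p b N.
Proof.
by rewrite /wsum mulr_sumr; apply: eq_bigr => k _; rewrite cpowM mulrCA.
Qed.

Lemma wsum_zero p b N : 0 < p -> (forall k, (k < N)%N -> b k = 0) -> wsum p b N = 0.
Proof.
by move=> p0 b0; rewrite /wsum big1 // => k _; rewrite b0 // cpow0 // mulr0.
Qed.

Lemma cpow_eq0 p (z : R[i]) : cpow p z = 0 -> z = 0.
Proof. by move/powR_eq0_eq0; rewrite cabsE => /ComplexField.Normc.eq0_normc. Qed.

Lemma wsum_eq0 p b N : wsum p b N = 0 -> forall k, (k < N)%N -> b k = 0.
Proof.
move=> /eqP; rewrite /wsum psumr_eq0 => [|k _]; last exact: wterm_ge0.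
move=> /allP W k kN; have := W (Ordinal kN) (mem_index_enum _).
rewrite /= mulf_eq0 expf_eq0 invr_eq0 pnatr_eq0 /= andbF /= => /eqP.
exact: cpow_eq0.
Qed.

Lemma Ap_wsumP p a : 0 < p ->
  Ap p (2 `^ (- p^-1)) a <-> exists B, forall N, wsum p a N <= B.
Proof.
move=> p0; pose e k := ((cabs (a k) * (2 `^ (- p^-1)) ^+ k) `^ p)%:E : \bar R.
have E N : (\sum_(0 <= k < N) e k)%E = (wsum p a N)%:E.
  rewrite sumEFin big_mkord; congr EFin; apply: eq_bigr => k _.
  rewrite powRM ?cabs_ge0 ?exprn_ge0 ?powR_ge0 // mulrC; congr (_ * _).
  rewrite -powR_mulrn ?powR_ge0 // -powRrM mulrC powRrM powR_mulrn ?powR_ge0 //.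
  by rewrite -powRrM mulNr mulVf ?gt_eqF // powR_inv1.
have e0 k : (0 <= e k)%E by rewrite lee_fin powR_ge0.
rewrite /Ap -/e; split => [H|[B HB]].
  exists (fine (\sum_(0 <= k <oo) e k)%E) => N.
  have F : (\sum_(0 <= k <oo) e k)%E \is a fin_num.
    by rewrite ge0_fin_numE // nneseries_ge0.
  by rewrite -lee_fin fineK // -E nneseries_lim_ge.
apply: (@le_lt_trans _ _ B%:E); last exact: ltry.
apply: lime_le; first by apply: is_cvg_nneseries => k _ _; exact: e0.
by apply: nearW => N; rewrite E lee_fin.
Qed.

Lemma cauchy_prod_ext a b b' n :
  (forall k, (k <= n)%N -> b k = b' k) -> cauchy_prod a b n = cauchy_prod a b' n.
Proof. by move=> bb'; apply: eq_bigr => i _; rewrite bb' // leq_subr. Qed.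

Lemma cauchy_prodZ a (l : R[i]) b n :
  cauchy_prod a (fun k => l * b k) n = l * cauchy_prod a b n.
Proof. by rewrite /cauchy_prod mulr_sumr; apply: eq_bigr => i _; rewrite mulrCA. Qed.

Lemma cauchy_prodB a b b' n :
  cauchy_prod a (fun k => b k - b' k) n = cauchy_prod a b n - cauchy_prod a b' n.
Proof. by rewrite /cauchy_prod -sumrB; apply: eq_bigr => i _; rewrite mulrBr. Qed.

Lemma cauchy_prod_shift a b M n :
  cauchy_prod a (fun k => if (M <= k)%N then b (k - M)%N else 0) (M + n)
  = cauchy_prod a b n.
Proof.
rewrite /cauchy_prod -!(big_mkord xpredT
  (fun i => a i * (if (M <= M + n - i)%N then b (M + n - i - M)%N else 0))).
rewrite (@big_cat_nat _ _ _ n.+1) //=; last by rewrite ltnS leq_addl.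
rewrite [X in _ + X]big_nat_cond [X in _ + X]big1 => [|i]; last first.
  rewrite andbT => /andP[ni iM]; rewrite ifF ?mulr0 //; lia.
rewrite addr0 big_mkord; apply: eq_bigr => i _; have := ltn_ord i => iM.
rewrite ifT; last by lia.
congr (_ * b _); lia.
Qed.

(** The Cauchy product commutes with shifts and scalars, so a large ratio of image to argument can
    be reproduced arbitrarily far out and with arbitrarily small norm. This supplies the humps. *)
Lemma unbounded_bump p a : 0 < p ->
  (forall K, 0 <= K -> exists b N, K * wsum p b N < wsum p (cauchy_prod a b) N) ->
  forall M K eps, 0 <= K -> 0 < eps -> exists u N,
    [/\ (M < N)%N, forall k, (k < M)%N -> u k = 0,
        wsum p u N <= eps & K <= wsum p (cauchy_prod a u) N].
Proof.
move=> p0 unb M K eps K0 eps0.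
have [b [N bN]] := unb (K / eps) (divr_ge0 K0 (ltW eps0)).
have W0 : 0 < wsum p b N.
  rewrite lt_neqAle wsum_ge0 andbT; apply/eqP => /esym W0.
  move: bN; rewrite W0 mulr0 wsum_zero ?ltxx // => k kN.
  rewrite /cauchy_prod big1 // => i _.
  by rewrite (wsum_eq0 _ _ _ W0) ?mulr0 // (leq_ltn_trans (leq_subr _ _)).
have N0 : (0 < N)%N by case: N bN {W0} => //; rewrite /wsum !big_ord0 mulr0 ltxx.
(* The shift by M divides both weighted sums by 2^M, and a scalar with |l|^p = r multiplies both by
   r; this r makes the shifted copy weigh exactly [eps]. *)
pose r := eps * 2 ^+ M / wsum p b N.
have r0 : 0 < r by rewrite divr_gt0 // mulr_gt0 // exprn_gt0.
pose l : R[i] := (r `^ p^-1)%:C.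
have lp : cpow p l = r.
  rewrite /cpow /cabs /= expr0n /= addr0 sqrtr_sqr ger0_norm ?powR_ge0 //.
  by rewrite -powRrM mulVf ?gt_eqF // powRr1 // ltW.
pose u0 k := l * b k.
pose u k := if (M <= k)%N then u0 (k - M)%N else 0.
have E1 : wsum p u (M + N) = eps.
  rewrite wsumD [X in X + _]wsum_zero ?add0r // => [|k kM]; last first.
    by rewrite /u leqNgt kM.
  rewrite (@eq_wsum _ _ u0) => [|k kN]; last by rewrite /u leq_addr addKn.
  rewrite wsumZ lp /r exprVn -!mulrA mulVf ?mulr1 ?gt_eqF //.
  by rewrite mulrCA mulVf ?mulr1 // expf_neq0.
have E2 : wsum p (cauchy_prod a u) (M + N)
          = eps / wsum p b N * wsum p (cauchy_prod a b) N.
  have Z k : (k < M)%N -> cauchy_prod a u k = 0.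
    move=> kM; rewrite /cauchy_prod big1 // => i _.
    by rewrite /u leqNgt (leq_ltn_trans (leq_subr _ _) kM) mulr0.
  rewrite wsumD (wsum_zero _ _ _ p0 Z) add0r.
  rewrite (@eq_wsum _ _ (fun k => l * cauchy_prod a b k)) => [|k kN]; last first.
    by rewrite /u cauchy_prod_shift cauchy_prodZ.
  rewrite wsumZ lp /r exprVn !mulrA; congr (_ / _ * _).
  by rewrite mulrC mulrA divff ?mul1r // expf_neq0.
exists u, (M + N)%N; split.
- by rewrite -addn1 leq_add2l.
- by move=> k kM; rewrite /u leqNgt kM.
- by rewrite E1.
rewrite E2 mulrAC ler_pdivlMr //; apply: le_trans (ler_wpM2l (ltW eps0) (ltW bN)).
by rewrite mulrA mulrCA divff ?gt_eqF // mulr1.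
Qed.

Lemma le_half_or (K y z : R) : 2 * K <= y + z -> K <= y \/ K <= z.
Proof. by have [|] := lerP K y; [left | right; lra]. Qed.

(* Since u = ((s + u) - (s - u)) / 2, one of the two signs keeps the image large. *)
Lemma unbounded_extend p a : 0 < p ->
  (forall K, 0 <= K -> exists b N, K * wsum p b N < wsum p (cauchy_prod a b) N) ->
  forall M s K eps, 0 <= K -> 0 < eps -> exists s' N,
    [/\ (M < N)%N, forall k, (k < M)%N -> s' k = s k,
        wsum p s' N <= wsum p s M + eps & K <= wsum p (cauchy_prod a s') N].
Proof.
move=> p0 unb M s K eps K0 eps0.
have [u [N [MN uM ue Ku]]] :=
  unbounded_bump p a p0 unb M (2 * K) eps (mulr_ge0 (ler0n _ 2) K0) eps0.
(* Only the new block carries the sign: both candidates agree with s below M, and the difference of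
   their images is twice the image of u. *)
pose sg (e : bool) k := if (k < M)%N then s k else (-1) ^+ e * u k.
have cpow_sg (e : bool) (z : R[i]) : cpow p ((-1) ^+ e * z) = cpow p z.
  by case: e; rewrite ?expr1 ?expr0 ?mulN1r ?mul1r ?cpowN.
have W e : wsum p (sg e) N <= wsum p s M + eps.
  rewrite -(subnKC (ltnW MN)) wsumD; apply: lerD.
    by rewrite (@eq_wsum _ _ s) // => k kM; rewrite /sg kM.
  apply: le_trans ue; rewrite -{2}(subnKC (ltnW MN)) wsumD.
  rewrite [X in _ <= X + _]wsum_zero // add0r ler_wpM2l ?exprn_ge0 ?invr_ge0 //.
  apply: ler_sum => k _; rewrite ler_wpM2l ?exprn_ge0 ?invr_ge0 //.
  by rewrite /sg ltnNge leq_addr /= cpow_sg.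
have H : wsum p (cauchy_prod a u) N <=
    wsum p (cauchy_prod a (sg false)) N + wsum p (cauchy_prod a (sg true)) N.
  rewrite -big_split /=; apply: ler_sum => k _.
  rewrite -mulrDr ler_wpM2l ?exprn_ge0 ?invr_ge0 //.
  have E : 2 * cauchy_prod a u k =
      cauchy_prod a (sg false) k - cauchy_prod a (sg true) k.
    rewrite -cauchy_prodB -cauchy_prodZ; apply: cauchy_prod_ext => i _.
    rewrite /sg; case: ltnP => iM; first by rewrite uM // mulr0 subrr.
    by rewrite expr0 expr1 mul1r mulN1r opprK mulr_natl mulr2n.
  have : cpow p (2 * cauchy_prod a u k) <= 2 `^ p * (cpow p (cauchy_prod a (sg false) k)
      + cpow p (cauchy_prod a (sg true) k)).
    by rewrite E (le_trans (cpow2_add_le _ _ _ p0)) // cpowN.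
  have c2 : cpow p (2 : R[i]) = 2 `^ p.
    have -> : (2 : R[i]) = (2%:R)%:C by rewrite rmorph_nat.
    by rewrite /cpow /cabs /= expr0n addr0 sqrtr_sqr ger0_norm.
  by rewrite cpowM c2 ler_pM2l // powR_gt0.
have [e He] : exists e, K <= wsum p (cauchy_prod a (sg e)) N.
  by case: (le_half_or _ _ _ (le_trans Ku H)) => Ky; [exists false | exists true].
exists (sg e), N; split => // k kM; by rewrite /sg kM.
Qed.

(* Gliding hump: an unbounded multiplier admits a sequence of disjoint blocks
   whose sum lies in the space while its image does not. *)
Lemma Mp_bounded p a : 0 < p -> Mp p (2 `^ (- p^-1)) a ->
  exists2 K, 0 <= K & forall b N, wsum p (cauchy_prod a b) N <= K * wsum p b N.
Proof.
move=> p0 [_ aM]; apply: contrapT => nK.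
have unb K : 0 <= K -> exists b N, K * wsum p b N < wsum p (cauchy_prod a b) N.
  move=> K0; apply: contrapT => H; apply: nK; exists K => // b N.
  by rewrite leNgt; apply/negP => bN; apply: H; exists b, N.
(* A state is (stage, (length, sequence)). Stage j may spend 2^-j of norm and must raise the image
   to at least j. *)
pose X := (nat * (nat * (nat -> R[i])))%type.
pose step (x y : X) := [/\ y.1 = x.1.+1, (x.2.1 < y.2.1)%N,
  forall k, (k < x.2.1)%N -> y.2.2 k = x.2.2 k,
  wsum p y.2.2 y.2.1 <= wsum p x.2.2 x.2.1 + 2^-1 ^+ x.1 &
  x.1%:R <= wsum p (cauchy_prod a y.2.2) y.2.1].
have ex x : {y | step x y}.
  apply: cid; case: x => j [M s].
  have e0 : 0 < (2^-1 : R) ^+ j by rewrite exprn_gt0 // invr_gt0.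
  have [s' [N [? ? ? ?]]] := unbounded_extend p a p0 unb M s j%:R _ (ler0n _ _) e0.
  by exists (j.+1, (N, s')); split.
have [F [F0 FS]] := dependent_choice ex (0%N, (0%N, fun=> 0)).
pose Nn j := (F j).2.1; pose sn j := (F j).2.2.
have F1 j : (F j).1 = j.
  by elim: j => [|j IH]; [rewrite F0 | have [-> _ _ _ _] := FS j; rewrite IH].
have NS j : (Nn j < Nn j.+1)%N by have [] := FS j.
have sS j k : (k < Nn j)%N -> sn j.+1 k = sn j k.
  by move=> H; have [_ _ + _ _] := FS j; apply.
have wS j : wsum p (sn j.+1) (Nn j.+1) <= wsum p (sn j) (Nn j) + 2^-1 ^+ j.
  by have [_ _ _ + _] := FS j; rewrite F1.
have aS j : j%:R <= wsum p (cauchy_prod a (sn j.+1)) (Nn j.+1).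
  by have [_ _ _ _ +] := FS j; rewrite F1.
have Nmono i j : (Nn i <= Nn (i + j))%N.
  elim: j => [|j IH]; first by rewrite addn0.
  by rewrite addnS (leq_trans IH) // ltnW.
have jN j : (j <= Nn j)%N by elim: j => // j IH; exact: leq_ltn_trans (NS j).
have sstab i j k : (k < Nn i)%N -> sn (i + j)%N k = sn i k.
  move=> ki; elim: j => [|j IH]; first by rewrite addn0.
  by rewrite addnS sS // (leq_trans ki).
(* Diagonal limit: since k < [Nn k.+1], entry k no longer changes from stage k.+1 on. *)
pose b k := sn k.+1 k.
have bE j k : (k < Nn j)%N -> b k = sn j k.
  move=> kj; rewrite /b; have [jk|kj1] := leqP j k.+1.
    by rewrite -(subnKC jk) sstab.
  by rewrite -(subnKC (ltnW kj1)) sstab // jN.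
(* The right-hand side is 1 + 1/2 + ... + 2^-(j-1), the norm budget of the first j stages. *)
have wb j : wsum p b (Nn j) <= 2 - 2 * 2^-1 ^+ j.
  rewrite (eq_wsum _ _ _ _ (bE j)).
  elim: j => [|j IH].
    by rewrite /Nn F0 /= /wsum big_ord0 expr0 mulr1 subrr.
  by rewrite (le_trans (wS j)) // exprS; lra.
have bA : Ap p (2 `^ (- p^-1)) b.
  apply/(Ap_wsumP _ _ p0); exists 2 => N; apply: le_trans (wsum_mono _ _ _ _ (jN N)) _.
  apply: le_trans (wb N) _; rewrite gerBl mulr_ge0 // exprn_ge0 // invr_ge0 //.
have /(Ap_wsumP _ _ p0)[B HB] := aM b bA.
pose j := (Num.truncn `|B|).+1.
have Bj : B < j%:R by rewrite (le_lt_trans (ler_norm _)) // truncnS_gt.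
have abE : wsum p (cauchy_prod a b) (Nn j.+1) =
           wsum p (cauchy_prod a (sn j.+1)) (Nn j.+1).
  apply: eq_wsum => k kN; apply: cauchy_prod_ext => i ik.
  by rewrite (bE j.+1) ?(leq_ltn_trans ik).
have := HB (Nn j.+1); rewrite abE => HB1.
by have := lt_le_trans Bj (le_trans (aS j) HB1); rewrite ltxx.
Qed.

(** Each step halves the weight, so with coefficient 3/2 in [cpow_add_le] the previous weighted term
    returns with factor 3/4 < 1. The constant is (K/2) / (1 - 3/4) = 2K. *)
Lemma prefix_sum_bounded p : 0 < p ->
  exists2 K, 0 <= K & forall b N, wsum p (fun n => \sum_(i < n) b i) N <= K * wsum p b N.
Proof.
move=> p0; have k1 : 1 < 3 / 2 :> R by lra.
have [K K0 HK] := cpow_add_le p (3 / 2) p0 k1.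
exists (2 * K) => [|b]; first by rewrite mulr_ge0.
elim=> [|N IH]; first by rewrite /wsum !big_ord0 mulr0.
pose P n := \sum_(i < n) b i.
have step k : 2^-1 ^+ k.+1 * cpow p (P k.+1) <=
    3 / 4 * (2^-1 ^+ k * cpow p (P k)) + K / 2 * (2^-1 ^+ k * cpow p (b k)).
  rewrite /P big_ord_recr exprS /= -/(P k).
  have t0 : 0 <= (2^-1 : R) ^+ k by rewrite exprn_ge0 // invr_ge0.
  have := ler_wpM2l t0 (HK (P k) (b k)).
  set x := cpow p (P k); set y := cpow p (b k); set z := cpow _ _; set t := _ ^+ _.
  by clear; lra.
rewrite /wsum big_ord_recl /= big_ord0 cpow0 // mulr0 add0r.
apply: (@le_trans _ _ (\sum_(k < N) (3 / 4 * (2^-1 ^+ k * cpow p (P k))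
    + K / 2 * (2^-1 ^+ k * cpow p (b k))))).
  by apply: ler_sum => k _; exact: step.
rewrite big_split /= -!mulr_sumr -/(wsum p P N) -/(wsum p b N) -/(wsum p b N.+1) wsumS.
have := wterm_ge0 p b N => /(mulr_ge0 K0).
move: IH; rewrite -/(wsum p P N).
set x := wsum p P N; set y := wsum p b N; set z := (_ ^+ _ * _).
by clear; lra.
Qed.

(* Taylor coefficients of (2 z - 1) / (1 - z): the Cauchy product with [c] gives the
   values of [\sum_k c_k h_(2^k)] on the intervals ]2^-(i+1), 2^-i]. *)
Definition cellsym (n : nat) : R[i] := if n == 0%N then -1 else 1.

Lemma cauchy_prod_cellsym b n : cauchy_prod cellsym b n = - b n + \sum_(i < n) b i.
Proof.
rewrite /cauchy_prod big_ord_recl /= /cellsym /= mulN1r subn0; congr (_ + _).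
rewrite (reindex_inj rev_ord_inj) /=; apply: eq_bigr => i _; rewrite mul1r.
by congr b; rewrite /bump /=; have := ltn_ord i; lia.
Qed.

Lemma cellsym_bounded p : 0 < p ->
  exists2 K, 0 <= K & forall b N, wsum p (cauchy_prod cellsym b) N <= K * wsum p b N.
Proof.
move=> p0; have [K K0 HK] := prefix_sum_bounded p p0.
exists (2 `^ p * (1 + K)) => [|b N]; first by rewrite mulr_ge0 ?powR_ge0 ?addr_ge0.
apply: (@le_trans _ _ (2 `^ p * (wsum p b N + wsum p (fun n => \sum_(i < n) b i) N))).
  rewrite -big_split /= mulr_sumr; apply: ler_sum => k _.
  rewrite -mulrDr mulrCA ler_wpM2l ?exprn_ge0 ?invr_ge0 //.
  by rewrite cauchy_prod_cellsym (le_trans (cpow2_add_le _ _ _ p0)) // cpowN.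
by rewrite -mulrA mulrDl mul1r ler_wpM2l ?powR_ge0 // lerD2l.
Qed.

(* A discrete Hardy inequality: in the weighted norm the backward recursion
   [s i = (s i.+1 + b i) / 2] contracts by the factor [2 ^ (1 - p) < 1]. *)
Lemma halving_bounded p : 1 < p ->
  exists2 K, 0 <= K & forall b s N, (forall i, s i *+ 2 = s i.+1 + b i) ->
    wsum p s N <= K * (wsum p b N + 2^-1 ^+ N * cpow p (s N)).
Proof.
move=> p1; have p0 : 0 < p by lra.
pose q := 2 `^ p : R.
have q2 : 2 < q.
  rewrite /q -mulr_powRB1 // ltr_pMr //.
  have : 1 `^ (p - 1) < 2 `^ (p - 1) :> R.
    by rewrite gt0_ltr_powR ?nnegrE ?subr_gt0 // ltr1n.
  by rewrite powR1.
(* The midpoint of 1 and q/2: it exceeds 1, as [cpow_add_le] requires, and satisfies 2k < q = 2^p.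
   Such a k exists because p > 1. *)
pose k := (q / 2 + 1) / 2.
have k1 : 1 < k by rewrite /k; lra.
have [K K0 HK] := cpow_add_le p k p0 k1.
pose e := q - 2 * k; have e0 : 0 < e by rewrite /e /k; lra.
have k20 : 0 <= 2 * k + K by lra.
exists ((2 * k + K) / e) => [|b s N sb]; first by rewrite divr_ge0 // ltW.
have step i : q * (2^-1 ^+ i * cpow p (s i)) <=
    2 * k * (2^-1 ^+ i.+1 * cpow p (s i.+1)) + K * (2^-1 ^+ i * cpow p (b i)).
  have E : q * cpow p (s i) = cpow p (s i.+1 + b i).
    rewrite -sb -mulr_natl cpowM; congr (_ * _).
    have -> : (2 : R[i]) = (2%:R)%:C by rewrite rmorph_nat.
    by rewrite /cpow /cabs /= expr0n addr0 sqrtr_sqr ger0_norm.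
  have t0 : 0 <= (2^-1 : R) ^+ i by rewrite exprn_ge0 // invr_ge0.
  have := ler_wpM2l t0 (HK (s i.+1) (b i)); rewrite -E exprS.
  set x := cpow p (s i); set y := cpow p (s i.+1); set z := cpow p _; set t := _ ^+ _.
  by clear; lra.
have : q * wsum p s N <= 2 * k * wsum p s N.+1 + K * wsum p b N.
  apply: (@le_trans _ _ (2 * k * (\sum_(i < N) 2^-1 ^+ i.+1 * cpow p (s i.+1))
     + K * wsum p b N)).
    rewrite /wsum !mulr_sumr -big_split /=; apply: ler_sum => i _; exact: step.
  rewrite lerD2r ler_wpM2l //; first by lra.
  by rewrite /wsum [leRHS]big_ord_recl /= lerDr (wterm_ge0 p s 0).
rewrite wsumS => H; rewrite mulrAC ler_pdivlMr //.
have := wterm_ge0 p s N; have := wsum_ge0 p b N; move: H; rewrite /e.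
set x := wsum p s N; set y := wsum p b N; set z := _ * cpow p (s N).
move=> H y0 z0; have k0 : 0 < k by lra.
have := mulr_ge0 (ltW k0) y0; have := mulr_ge0 K0 z0; lra.
Qed.

End WeightedSums.

(** * Arithmetic of indices: level, shift, binary ones, odd part *)

Lemma hlev_double n : (0 < n)%N -> hlev (2 * n) = (hlev n).+1.
Proof. by move=> n0; rewrite /hlev mul2n trunc_log2_double. Qed.

Lemma hlev_bounds n : (0 < n)%N -> (2 ^ hlev n <= n < 2 ^ (hlev n).+1)%N.
Proof. by move=> n0; exact: trunc_log_bounds. Qed.

Lemma hlevP n l : (2 ^ l <= n < 2 ^ l.+1)%N -> hlev n = l.
Proof. exact: trunc_log_eq. Qed.

Lemma hlev_doubleS n : (0 < n)%N -> hlev (2 * n).+1 = (hlev n).+1.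
Proof.
move=> n0; apply: hlevP; have /andP[H1 H2] := hlev_bounds n n0.
rewrite !expnS in H2 *; lia.
Qed.

Lemma hshift_double n : (0 < n)%N -> hshift (2 * n) = (2 * hshift n)%N.
Proof. by move=> n0; rewrite /hshift hlev_double // expnS mulnBr. Qed.

Lemma hshift_doubleS n : (0 < n)%N -> hshift (2 * n).+1 = (2 * hshift n).+1.
Proof.
move=> n0; rewrite /hshift hlev_doubleS // expnS mulnBr subSn //.
by have /andP[H1 _] := hlev_bounds n n0; rewrite leq_mul2l.
Qed.

Lemma hlev_mul_exp n i : (0 < n)%N -> hlev (n * 2 ^ i) = (hlev n + i)%N.
Proof.
move=> n0; elim: i => [|i IH]; first by rewrite expn0 muln1 addn0.
by rewrite expnS mulnCA hlev_double ?IH ?addnS // muln_gt0 n0 expn_gt0.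
Qed.

Lemma hshift_mul_exp n i : (0 < n)%N -> hshift (n * 2 ^ i) = (hshift n * 2 ^ i)%N.
Proof. by move=> n0; rewrite /hshift hlev_mul_exp // expnD mulnBl. Qed.

Lemma hlev1 : hlev 1 = 0%N. Proof. exact: hlevP. Qed.

Lemma hshift1 : hshift 1 = 0%N. Proof. by rewrite /hshift hlev1. Qed.

(** The range of the sum in [bitcount] depends on n; bits of index above n vanish, so two such sums
    can be brought to a common range. *)
Lemma bitcount_widen n M : (n < M)%N -> (\sum_(i < M) odd (n %/ 2 ^ i))%N = bitcount n.
Proof.
move=> nM; rewrite /bitcount -!(big_mkord xpredT (fun i => nat_of_bool (odd (n %/ 2 ^ i)))).
rewrite (@big_cat_nat _ _ _ n.+1) //= [X in (_ + X)%N]big_nat_cond.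
rewrite [X in (_ + X)%N]big1 ?addn0 // => i; rewrite andbT => /andP[ni _].
by rewrite divn_small // (leq_trans ni) // ltnW // ltn_expl.
Qed.

Lemma bitcount_double n : bitcount (2 * n) = bitcount n.
Proof.
have [->|n0] := posnP n; first by rewrite muln0.
rewrite /bitcount big_ord_recl expn0 divn1 mul2n odd_double add0n.
transitivity (\sum_(i < n.*2) odd (n %/ 2 ^ i))%N.
  by apply: eq_bigr => i _; rewrite /= /bump add1n expnS divnMA divn2 doubleK.
by rewrite bitcount_widen // -addnn; lia.
Qed.

Lemma bitcount_doubleS n : bitcount (2 * n).+1 = (bitcount n).+1.
Proof.
rewrite /bitcount big_ord_recl expn0 divn1 mul2n /= odd_double add1n; congr _.+1.
transitivity (\sum_(i < n.*2.+1) odd (n %/ 2 ^ i))%N.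
  by apply: eq_bigr => i _; rewrite /= /bump add1n expnS divnMA divn2 -uphalfE uphalf_double.
by rewrite bitcount_widen // -addnn; lia.
Qed.

Lemma bitcount_mul_exp n i : bitcount (n * 2 ^ i) = bitcount n.
Proof.
by elim: i => [|i IH]; rewrite ?expn0 ?muln1 // expnS mulnCA bitcount_double.
Qed.

Lemma bitcount0 : bitcount 0 = 0%N.
Proof. by rewrite /bitcount big_ord_recl big_ord0. Qed.

Lemma odd_part_exists n : (0 < n)%N -> exists k i, n = ((2 * k).+1 * 2 ^ i)%N.
Proof.
elim/ltn_ind: n => n IH n0; case on: (odd n).
  by exists n./2, 0%N; rewrite expn0 muln1 -[LHS]odd_double_half on mul2n.
have E := odd_double_half n; rewrite on add0n in E.
have [||k [i ki]] := IH n./2; [lia|lia|].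
by exists k, i.+1; rewrite expnS mulnCA -ki mul2n.
Qed.

Lemma bitcount_odd_part k i : bitcount ((2 * k).+1 * 2 ^ i) = (bitcount k).+1.
Proof. by rewrite bitcount_mul_exp bitcount_doubleS. Qed.

Lemma bitcount_gt0 n : (0 < n)%N -> (0 < bitcount n)%N.
Proof. by move=> /odd_part_exists[k [i ->]]; rewrite bitcount_odd_part. Qed.

Lemma logn_odd_part k i : logn 2 ((2 * k).+1 * 2 ^ i) = i.
Proof.
rewrite lognM ?expn_gt0 // pfactorK // [X in (X + _)%N]logn_coprime ?add0n //.
by rewrite coprime_sym coprimen2 /= mul2n odd_double.
Qed.

Lemma divn_odd_part q i j : (j <= i)%N -> (q * 2 ^ i %/ 2 ^ j = q * 2 ^ (i - j))%N.
Proof. by move=> ji; rewrite -{1}(subnK ji) expnD mulnA mulnK // expn_gt0. Qed.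

(** * The dyadic tree and its partitions into cells *)

Section Tree.
Context {R : realType}.
Implicit Types (t : R).

Definition node n : set R := [set t |
  ((hshift n)%:R / (2 ^+ hlev n) < t) && (t <= (hshift n).+1%:R / (2 ^+ hlev n))].

(* The right half of the node [n], where the Haar function [h_n] is [-1];
   [cell 0] is the whole of (0, 1]. *)
Definition cell n : set R := node (2 * n).+1.

Lemma nodeE n t : node n t <-> ((hshift n)%:R < 2 ^+ hlev n * t <= (hshift n).+1%:R).
Proof. by rewrite /node /= ltr_pdivrMr ?ler_pdivlMr ?exprn_gt0 // mulrC. Qed.

Lemma node1 t : node 1 t <-> 0 < t <= 1.
Proof. by rewrite nodeE hshift1 hlev1 expr0 mul1r. Qed.

Lemma cell0 t : cell 0 t <-> 0 < t <= 1. Proof. exact: node1. Qed.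

Lemma node_left n t : (0 < n)%N -> node (2 * n) t <-> 
  ((hshift n)%:R < 2 ^+ hlev n * t <= (hshift n)%:R + 2^-1).
Proof.
move=> n0; rewrite nodeE hlev_double // hshift_double // exprS.
rewrite -[(2 * hshift n).+1%:R]natr1 natrM -mulrA.
set s := (hshift n)%:R; set y := 2 ^+ hlev n * t.
by split => /andP[? ?]; apply/andP; split; lra.
Qed.

Lemma node_right n t : (0 < n)%N -> cell n t <-> 
  ((hshift n)%:R + 2^-1 < 2 ^+ hlev n * t <= (hshift n).+1%:R).
Proof.
move=> n0; rewrite /cell nodeE hlev_doubleS // hshift_doubleS // exprS.
rewrite -[(2 * hshift n).+2%:R]natr1 -[(2 * hshift n).+1%:R]natr1.
rewrite -[(hshift n).+1%:R]natr1 natrM -mulrA.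
set s := (hshift n)%:R; set y := 2 ^+ hlev n * t.
by split => /andP[? ?]; apply/andP; split; lra.
Qed.

Lemma node_split n t : (0 < n)%N -> node n t <-> node (2 * n) t \/ cell n t.
Proof.
move=> n0; rewrite node_left // node_right // nodeE -[(hshift n).+1%:R]natr1.
set s := (hshift n)%:R; set y := 2 ^+ hlev n * t; split.
  by move=> /andP[? ?]; have [?|?] := leP y (s + 2^-1); [left|right]; apply/andP; split; lra.
by move=> [|] /andP[? ?]; apply/andP; split; lra.
Qed.

Lemma node_left_right n t : (0 < n)%N -> node (2 * n) t -> cell n t -> False.
Proof. by move=> n0; rewrite node_left // node_right // => /andP[? ?] /andP[? ?]; lra. Qed.

(** In the coordinate u = 2^(hlev n) t - hshift n, which maps the node n onto (0, 1], the condition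
    reads 2^-(i+1) < u <= 2^-i: the cells of a chain are dyadic rings accumulating at the left
    endpoint. *)
Lemma cell_mul_exp n i t : (0 < n)%N -> cell (n * 2 ^ i) t <->
  (1 < 2 ^+ i.+1 * (2 ^+ hlev n * t - (hshift n)%:R) <= 2).
Proof.
move=> n0; rewrite /cell nodeE.
rewrite hlev_doubleS ?hshift_doubleS ?muln_gt0 ?n0 ?expn_gt0 //.
rewrite hlev_mul_exp // hshift_mul_exp // mulnCA -expnS [(hshift n * _)%N]mulnC -addnS addnC exprD.
rewrite -[(2 ^ i.+1 * hshift n).+2%:R]natr1 -[(2 ^ i.+1 * hshift n).+1%:R]natr1.
rewrite natrM natrX -mulrA mulrBr.
set x := 2 ^+ i.+1; set s := (hshift n)%:R; set y := _ * t; set z := x * y.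
by set w := x * s; split => /andP[? ?]; apply/andP; split; lra.
Qed.

Lemma dyadic_scale_exists (u : R) : 0 < u <= 1 -> exists i, 1 < 2 ^+ i.+1 * u <= 2.
Proof.
move=> /andP[u0 u1].
have ex : exists i, 1 < 2 ^+ i.+1 * u.
  exists (Num.truncn u^-1); rewrite -ltr_pdivrMr // div1r.
  apply: lt_trans (truncnS_gt _) _; rewrite -natrX ltr_nat; exact: ltn_expl.
exists (ex_minn ex); case: ex_minnP => i iu imin; apply/andP; split => //.
case: i iu imin => [|i] iu imin; first by rewrite expr1; lra.
rewrite leNgt; apply/negP => H.
have := imin i; rewrite ltnn => F; suff: false by []; apply: F.
by move: H; rewrite exprS; lra.
Qed.

Lemma dyadic_scale_uniq (u : R) i j : 0 < u ->
  1 < 2 ^+ i.+1 * u <= 2 -> 1 < 2 ^+ j.+1 * u <= 2 -> i = j.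
Proof.
move=> u0; wlog ij : i j / (i < j)%N => [W|] /andP[i1 i2] /andP[j1 j2].
  case: (ltngtP i j) => // ij; first by apply: W => //; apply/andP; split.
  by apply/esym; apply: W => //; apply/andP; split.
have : 2 ^+ i.+2 * u <= 2 ^+ j.+1 * u by rewrite ler_pM2r // ler_eXn2l // ltr1n.
move=> H; exfalso; move: H i1 j2; rewrite [2 ^+ i.+2]exprS -mulrA.
set x := 2 ^+ i.+1 * u; set y := 2 ^+ j.+1 * u; clear; lra.
Qed.

Lemma node_chain n t : (0 < n)%N -> node n t <-> exists i, cell (n * 2 ^ i) t.
Proof.
move=> n0; rewrite nodeE; split.
  move=> /andP[a b]; have [|i Hi] := dyadic_scale_exists (2 ^+ hlev n * t - (hshift n)%:R).
    by rewrite -natr1 in b; apply/andP; split; lra.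
  by exists i; rewrite cell_mul_exp.
case=> i; rewrite cell_mul_exp // exprS; set u := _ - _ => /andP[i1 i2].
have x1 : 1 <= (2 : R) ^+ i by rewrite exprn_ege1 // ler1n.
have u0 : 0 < u.
  rewrite ltNge; apply/negP => u0.
  have : 2 * 2 ^+ i * u <= 0 by rewrite pmulr_rle0 // mulr_gt0 // exprn_gt0.
  lra.
have u1 : u <= 1.
  have : u <= 2 ^+ i * u by rewrite ler_pMl.
  by move: i2; rewrite -mulrA; lra.
by rewrite -natr1; move: u0 u1; rewrite /u => ? ?; apply/andP; split; lra.
Qed.

Lemma cell_chain_uniq n i j t : (0 < n)%N ->
  cell (n * 2 ^ i) t -> cell (n * 2 ^ j) t -> i = j.
Proof.
move=> n0 ci cj; have /nodeE/andP[H _] : node n t by apply/node_chain => //; exists i.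
move: ci cj; rewrite !cell_mul_exp //; apply: dyadic_scale_uniq; lra.
Qed.

(** By definition the cell k is the node 2k+1, so [node_chain] splits it into the cells along the
    chain of 2k+1. This is how the cells with one more binary one refine those of the previous
    order. *)
Lemma cell_odd_part k i t : cell ((2 * k).+1 * 2 ^ i) t -> cell k t.
Proof. by move=> H; apply/node_chain => //; exists i. Qed.

(** Induction on the number of ones: write both indices as (2k+1) 2^i. The two values of k have one
    bit fewer and their cells contain t, so they agree; the rings of one chain are disjoint, so the
    exponents agree. *)
Lemma cell_uniq m n t : cell m t -> cell n t -> bitcount m = bitcount n -> m = n.
Proof.
move: {2}(bitcount m) (erefl (bitcount m)) => D; elim: D m n => [|D IH] m n.
  move=> m0 _ _ n0; have mn0 k : bitcount k = 0%N -> k = 0%N.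
    by case: (posnP k) => // /bitcount_gt0 + k0; rewrite k0.
  by rewrite (mn0 m) // (mn0 n) // -n0.
move=> bm cm cn bmn.
have [m0|] := posnP m; first by rewrite m0 bitcount0 in bm.
have [n0|] := posnP n; first by rewrite bmn n0 bitcount0 in bm.
move=> /odd_part_exists[k [i En]] /odd_part_exists[l [j Em]].
move: bm cm cn bmn; rewrite {}En {}Em !bitcount_odd_part => -[bl] cl ck [blk].
have E := IH _ _ bl (cell_odd_part _ _ _ cl) (cell_odd_part _ _ _ ck) blk.
by rewrite E in cl *; rewrite (cell_chain_uniq _ _ _ _ _ cl ck).
Qed.

Lemma cell_cover D t : 0 < t <= 1 -> exists m, bitcount m = D /\ cell m t.
Proof.
move=> t01; elim: D => [|D [m [bm cm]]].
  by exists 0%N; rewrite bitcount0; split=> //; apply/cell0.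
have /node_chain[//|i ci] := cm.
by exists ((2 * m).+1 * 2 ^ i)%N; rewrite bitcount_odd_part bm.
Qed.

Lemma cell_sub n t : cell n t -> 0 < t <= 1.
Proof.
have [->|] := posnP n; first by move/cell0.
elim/ltn_ind: n => n IH /odd_part_exists[k [i E]]; rewrite {1}E.
move/cell_odd_part; have [->|k0] := posnP k; first by move/cell0.
apply: IH => //; rewrite E (@leq_trans (2 * k).+1) //; first by lia.
by rewrite leq_pmulr // expn_gt0.
Qed.

Lemma node_sub n t : (0 < n)%N -> node n t -> 0 < t <= 1.
Proof. by move=> n0 /node_chain[//|i]; exact: cell_sub. Qed.

(* The cell containing [t] among those with [D] binary ones. *)
Definition stem D t : nat := xget 0%N [set m | bitcount m = D /\ cell m t].

Lemma stemP D t : 0 < t <= 1 -> bitcount (stem D t) = D /\ cell (stem D t) t.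
Proof. by move=> /(cell_cover D)[m Hm]; exact: (@xgetPex _ 0%N [set m | bitcount m = D /\ cell m t]) (ex_intro _ m Hm). Qed.

Lemma stem_eq m t : cell m t -> stem (bitcount m) t = m.
Proof.
move=> cm; have [b c] := stemP (bitcount m) t (cell_sub _ _ cm).
exact: cell_uniq c cm b.
Qed.

Lemma stem_gt0 D t : 0 < t <= 1 -> (0 < D)%N -> (0 < stem D t)%N.
Proof.
move=> t01; have [+ _] := stemP D t t01.
by case: (stem D t) => // <-; rewrite bitcount0.
Qed.

Lemma stem0 t : 0 < t <= 1 -> stem 0 t = 0%N.
Proof. by move=> /cell0/stem_eq; rewrite bitcount0. Qed.

Lemma stemS D t : 0 < t <= 1 -> exists i, stem D.+1 t = ((2 * stem D t).+1 * 2 ^ i)%N.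
Proof.
move=> t01; have [b c] := stemP D t t01.
have /node_chain[//|i ci] := c; exists i.
by have := stem_eq _ _ ci; rewrite bitcount_odd_part b.
Qed.

End Tree.

(** * Cauchy products acting along the chains q, 2q, 4q, .. *)

Section CauchyAlgebra.
Context {R : realType}.
Implicit Types (a b c g S : nat -> R[i]).

(** Only finitely many coefficients matter at each index, so associativity can be borrowed from
    polynomials. *)
Lemma cauchy_prod_coef a b N k : (k < N)%N ->
  cauchy_prod a b k = ((\poly_(i < N) a i) * (\poly_(i < N) b i))`_k.
Proof.
move=> kN; rewrite coefM; apply: eq_bigr => i _; rewrite !coef_poly.
by rewrite !ifT // ?(leq_ltn_trans (leq_subr _ _)) // (leq_ltn_trans _ kN) // -ltnS.
Qed.

Lemma cauchy_prodA a b c n :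
  cauchy_prod a (cauchy_prod b c) n = cauchy_prod (cauchy_prod a b) c n.
Proof.
pose P (u : nat -> R[i]) := \poly_(i < n.+1) u i.
have E u v i : (i < n.+1)%N -> (P (cauchy_prod u v))`_i = (P u * P v)`_i.
  by move=> iN; rewrite coef_poly iN (cauchy_prod_coef _ _ _ _ iN).
rewrite !(cauchy_prod_coef _ _ _ _ (ltnSn n)).
transitivity ((P a * (P b * P c))`_n).
  rewrite !coefM; apply: eq_bigr => i _; rewrite -/(P (cauchy_prod b c)) E //.
  by rewrite ltnS leq_subr.
rewrite mulrA 2!coefM; apply: eq_bigr => i _.
by rewrite -/(P (cauchy_prod a b)) E.
Qed.

Lemma cauchy_prod_delta b n :
  cauchy_prod (fun k => (k == 0%N)%:R) b n = b n.
Proof.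
rewrite /cauchy_prod big_ord_recl /= mul1r subn0 big1 ?addr0 // => i _.
by rewrite mul0r.
Qed.

Lemma cauchy_prod_extl a a' b n :
  a =1 a' -> cauchy_prod a b n = cauchy_prod a' b n.
Proof. by move=> aa'; apply: eq_bigr => i _; rewrite aa'. Qed.

(** The power series with coefficients a, with z acting as the dilation n -> 2n. Both sides of the
    expansion have this form: pairing with g^n (a = d) and evaluating a sum of dilations of f on a
    cell (a = the values of f). *)
Definition dilconv a g n : R[i] := \sum_(j < (logn 2 n).+1) a j * g (n %/ 2 ^ j)%N.

Lemma dilconv_chain a g k i : dilconv a g ((2 * k).+1 * 2 ^ i) =
  cauchy_prod a (fun l => g ((2 * k).+1 * 2 ^ l)%N) i.
Proof.
rewrite /dilconv logn_odd_part; apply: eq_bigr => j _.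
by rewrite divn_odd_part // -ltnS.
Qed.

Lemma dilconv_cancel a c d g n : (0 < n)%N ->
  (forall n, cauchy_prod c d n = (n == 0%N)%:R) ->
  dilconv (cauchy_prod a c) (dilconv d g) n = dilconv a g n.
Proof.
move=> /odd_part_exists[k [i ->]] cd; rewrite !dilconv_chain.
under cauchy_prod_ext => l _ do rewrite dilconv_chain.
rewrite -cauchy_prodA; apply: cauchy_prod_ext => l _.
by rewrite cauchy_prodA (cauchy_prod_extl _ _ _ _ cd) cauchy_prod_delta.
Qed.

Lemma dilconvB a g g' n : dilconv a (fun k => g k - g' k) n = dilconv a g n - dilconv a g' n.
Proof. by rewrite /dilconv -sumrB; apply: eq_bigr => i _; rewrite mulrBr. Qed.

(* Along a chain the sum telescopes to the difference of [S] between the right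
   child of [m] and the odd root of its chain. *)
Lemma dilconv_cellsym S k i : (forall n, (0 < n)%N -> S (2 * n)%N + S (2 * n).+1 = S n *+ 2) ->
  let m := ((2 * k).+1 * 2 ^ i)%N in
  dilconv cellsym (fun n => S (2 * n)%N - S n) m = S (2 * m).+1 - S (2 * k).+1.
Proof.
move=> HS m; rewrite dilconv_chain cauchy_prod_cellsym.
have -> : \sum_(j < i) (S (2 * ((2 * k).+1 * 2 ^ j))%N - S ((2 * k).+1 * 2 ^ j)%N)
    = S m - S (2 * k).+1.
  rewrite /m; elim: i {m} => [|i IH]; first by rewrite big_ord0 expn0 muln1 subrr.
  rewrite big_ord_recr /= IH [in RHS]expnS [in RHS]mulnCA.
  by rewrite addrC addrA subrK.
have := HS m; rewrite muln_gt0 expn_gt0 /= => /(_ isT) H.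
rewrite -/m.
have -> : S (2 * m).+1 = S m *+ 2 - S (2 * m)%N by rewrite -H addrAC subrr add0r.
by rewrite mulr2n; ring.
Qed.

End CauchyAlgebra.

(** * Values of first-order chaoses and of their dilations on cells *)

Section FirstOrderChaos.
Context {R : realType}.
Implicit Types (t : R) (c eta S : nat -> R[i]).

Lemma haarE n t : (0 < n)%N -> haar n t = (\1_(node (2 * n)%N) t - \1_(cell n) t)%:C.
Proof.
move=> n0; rewrite /haar /dil -/(node n t).
have nl := node_left n t n0; have nr := node_right n t n0.
have nE := nodeE n t; rewrite -[(hshift n).+1%:R]natr1 in nE nr.
rewrite !indicE /haar0; set y := 2 ^+ hlev n * t in nl nr nE *.
set s := (hshift n)%:R in nl nr nE *.
case: ifPn => [/nE/andP[sy ys]|/negP nn].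
  rewrite subr_gt0 sy /=; have [ys2|ys2] := leP (y - s) 2^-1.
    rewrite mem_set; last by apply/nl/andP; split; lra.
    rewrite memNset ?subr0 // => /nr/andP[? ?]; lra.
  rewrite memNset; last by move=> /nl/andP[? ?]; lra.
  rewrite mem_set; last by apply/nr/andP; split; lra.
  by rewrite ifT ?sub0r //=; lra.
rewrite !memNset ?subrr // => [/nr|/nl] /andP[? ?]; apply: nn; apply/nE/andP; split; lra.
Qed.

(** The cell 2^i is the interval (2^-(i+1), 2^-i], while h_(2^k) is 1 on (0, 2^-(k+1)] and -1 on
    (2^-(k+1), 2^-k]. *)
Lemma haar_pow2_cell k i t : cell (2 ^ i) t ->
  haar (2 ^ k) t = if (k < i)%N then 1 else if k == i then -1 else 0.
Proof.
move=> ci; have t0 : 0 < t <= 1 := cell_sub _ _ ci; case/andP: t0 => t0 t1.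
have /(node_chain 1 t isT) H1 : node 1 t by apply/node1/andP.
rewrite haarE ?expn_gt0 // !indicE.
have nE j : node (2 ^ j)%N t <-> 2 ^+ j * t <= 1.
  rewrite nodeE -[(2 ^ j)%N]mul1n hlev_mul_exp // hshift_mul_exp // hlev1 hshift1.
  by rewrite mul0n add0n mulr_gt0 // exprn_gt0.
have := ci; rewrite -[(2 ^ i)%N]mul1n cell_mul_exp // hlev1 hshift1 expr0 mul1r subr0.
move=> /andP[i1 i2].
have cE : cell (2 ^ k)%N t <-> k = i.
  split=> [ck|->//]; have := cell_chain_uniq 1 k i t isT.
  by rewrite !mul1n; apply.
rewrite -expnS; case: ltngtP => ki.
- rewrite mem_set; last first.
    apply/nE; apply: (@le_trans _ _ (2 ^+ i * t)).
      by rewrite ler_pM2r // ler_eXn2l // ltr1n.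
    by move: i2; rewrite exprS -mulrA; lra.
  by rewrite memNset ?subr0 // => /cE E; rewrite E ltnn in ki.
- rewrite memNset; last first.
    move=> /nE; apply/negP; rewrite -ltNge; apply: (lt_le_trans i1).
    by rewrite ler_pM2r // ler_eXn2l ?ltr1n // ltnW // ltnS.
  by rewrite memNset ?subr0 // => /cE E; rewrite E ltnn in ki.
- rewrite ki memNset; last by move=> /nE; rewrite leNgt i1.
  by rewrite mem_set // sub0r rmorphN.
Qed.

Lemma first_order_value c (f : R -> R[i]) i t :
  (forall t : R, 0 < t <= 1 -> exists N0 : nat, forall N : nat, (N0 <= N)%N ->
      f t = \sum_(k < N) c k * haar (2 ^ k) t) ->
  cell (2 ^ i) t -> f t = cauchy_prod cellsym c i.
Proof.
move=> Hf ci; have [N0 HN] := Hf t (cell_sub _ _ ci).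
(* The length is at least N0, as the expansion requires, and exceeds i, so that all terms that can
   be nonzero on this cell are included. *)
rewrite (HN (i.+1 + N0)%N) ?leq_addl // big_split_ord /= [X in _ + X]big1 => [|k _].
  rewrite addr0 big_ord_recr /= cauchy_prod_cellsym addrC.
  rewrite (haar_pow2_cell _ i) // ltnn eqxx mulrN1; congr (_ + _).
  by apply: eq_bigr => k _; rewrite (haar_pow2_cell _ i) // ltn_ord mulr1.
rewrite (haar_pow2_cell _ i) // !ifF ?mulr0 //; lia.
Qed.

Lemma dil_cell (f : R -> R[i]) (phi : nat -> R[i]) n j t :
  (forall i t, cell (2 ^ i) t -> f t = phi i) -> (0 < n)%N ->
  cell (n * 2 ^ j) t -> dil f n t = phi j.
Proof.
move=> Hf n0 cj; have nt : node n t by apply/node_chain => //; exists j.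
rewrite /dil -/(node n t) nt; apply: Hf.
have := cj; rewrite cell_mul_exp // => cj'.
by rewrite -[(2 ^ j)%N]mul1n cell_mul_exp // hlev1 hshift1 expr0 mul1r subr0.
Qed.

Lemma dil_off (f : R -> R[i]) n t : ~ node n t -> dil f n t = 0.
Proof. by move=> nt; rewrite /dil ifF //; apply/negP. Qed.

Lemma dil_stem (f : R -> R[i]) (phi : nat -> R[i]) n k i t :
  (forall i t, cell (2 ^ i) t -> f t = phi i) -> (0 < n)%N ->
  let m := ((2 * k).+1 * 2 ^ i)%N in
  cell m t -> bitcount n = bitcount m ->
  dil f n t = \sum_(j < i.+1) phi j * (m %/ 2 ^ j == n)%N%:R.
Proof.
move=> Hf n0 m cm bnm.
have E j : (j <= i)%N -> (m %/ 2 ^ j)%N = n -> m = (n * 2 ^ j)%N.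
  by move=> ji <-; rewrite /m divn_odd_part // -mulnA -expnD subnK.
have [nt|nt] := pselect (node n t); last first.
  rewrite dil_off // big1 // => j _; case: eqP => [H|_]; last by rewrite mulr0.
  by exfalso; apply: nt; apply/node_chain => //; exists j; rewrite -E // -ltnS.
have [j cj] := (node_chain n t n0).1 nt.
have mE : m = (n * 2 ^ j)%N by apply: cell_uniq cm cj _; rewrite bitcount_mul_exp.
have ji : (j <= i)%N.
  by rewrite -(logn_odd_part k i) -/m mE lognM ?expn_gt0 // pfactorK // leq_addl.
rewrite (dil_cell _ phi n j t) // (bigD1 (Ordinal (ji : (j < i.+1)%N))) //=.
rewrite {1}mE mulnK ?expn_gt0 // eqxx mulr1 big1 ?addr0 // => l lj.
case: eqP => [H|_]; last by rewrite mulr0.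
exfalso; move/eqP: lj; apply; apply: val_inj => /=.
by apply: (cell_chain_uniq n l j t n0) => //; rewrite -E // -ltnS.
Qed.

(** A partial sum of the series is the full operator applied to truncated coefficients, so any bound
    for the operator also controls the error. *)
Lemma partial_sum_stem (f : R -> R[i]) (phi eta : nat -> R[i]) D N t :
  (forall i t, cell (2 ^ i) t -> f t = phi i) -> (0 < D)%N -> 0 < t <= 1 ->
  \sum_(1 <= n < N | bitcount n == D) eta n * dil f n t =
  dilconv phi (fun k => if (k < N)%N then eta k else 0) (stem D t).
Proof.
move=> Hf D0 t01; have [bm cm] := stemP D t t01.
have /odd_part_exists[k [i mE]] := stem_gt0 D t t01 D0.
rewrite mE in bm cm *; rewrite /dilconv logn_odd_part.
set m := (_ * _)%N in bm cm *.
transitivity (\sum_(1 <= n < N | bitcount n == D) \sum_(j < i.+1)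
    phi j * ((m %/ 2 ^ j == n)%N%:R * eta n)).
  rewrite big_nat_cond [RHS]big_nat_cond; apply: eq_bigr => n /andP[/andP[n1 nN] /eqP bn].
  rewrite (dil_stem f phi n k i t) -/m ?bm // mulr_sumr; apply: eq_bigr => j _.
  by rewrite mulrCA mulrA mulrAC mulrA mulrC mulrA.
rewrite exchange_big /=; apply: eq_bigr => j _; rewrite -mulr_sumr; congr (_ * _).
have ji : (j <= i)%N by rewrite -ltnS.
have mj0 : (0 < m %/ 2 ^ j)%N by rewrite /m divn_odd_part // muln_gt0 expn_gt0.
have bmj : bitcount (m %/ 2 ^ j) = D.
  by rewrite -bm /m divn_odd_part // !bitcount_mul_exp.
case: ifPn => mN.
  have mi : (m %/ 2 ^ j)%N \in index_iota 1 N by rewrite mem_index_iota mj0.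
  rewrite big_mkcond (bigD1_seq _ mi (iota_uniq _ _)) /= bmj !eqxx mul1r.
  rewrite big1 ?addr0 // => n nm; rewrite [_ == n]eq_sym (negbTE nm) mul0r.
  by case: ifP.
rewrite big_nat_cond big1 // => n /andP[/andP[_ nN] _].
by case: eqP => [E|_]; rewrite ?mul0r //; rewrite E nN in mN.
Qed.

(** By [stemS] the odd root of the chain of [stem D.+1 t] is the right child of [stem D t], so the
    differences given by [dilconv_cellsym] cancel from one order to the next. *)
Lemma chaos_sum_telescope S M t :
  (forall n, (0 < n)%N -> S (2 * n)%N + S (2 * n).+1 = S n *+ 2) -> 0 < t <= 1 ->
  \sum_(1 <= D < M.+1) dilconv cellsym (fun n => S (2 * n)%N - S n) (stem D t) =
  S (2 * stem M t).+1 - S 1%N.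
Proof.
move=> HS t01; elim: M => [|M IH]; first by rewrite big_geq // stem0 // subrr.
rewrite big_nat_recr //= IH; have [i ->] := stemS M t t01.
by rewrite dilconv_cellsym // addrC addrA subrK.
Qed.

End FirstOrderChaos.

(** * The weighted l^p mass of a chaos, summed chain by chain *)

Section ChainSeries.
Context {R : realType}.
Local Open Scope ereal_scope.

(** The map (k, i) -> (2k+1) 2^i is a bijection from pairs with k of order D onto the indices of
    order D+1. *)
Lemma nneseries_chain (g : nat -> \bar R) D : (forall n, 0 <= g n) ->
  \sum_(0 <= m <oo | bitcount m == D.+1) g m =
  \sum_(0 <= k <oo | bitcount k == D) \sum_(0 <= i <oo) g ((2 * k).+1 * 2 ^ i)%N.
Proof.
move=> g0; rewrite nneseries_esum // nneseries_esum => [|k _]; last first.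
  by apply: nneseries_ge0.
under [RHS]eq_esum => k _ do rewrite nneseries_esumT //.
rewrite esum_esum //.
rewrite (@reindex_esum _ _ _ ([set k | bitcount k == D] `*`` (fun=> setT)) _
  (fun x => ((2 * x.1).+1 * 2 ^ x.2)%N)) //; split.
- by move=> [k i] /= [/eqP <- _]; rewrite bitcount_odd_part.
- move=> [k i] [l j] _ _ /= E.
  have ij : i = j by rewrite -(logn_odd_part k i) E logn_odd_part.
  move: E; rewrite ij => /eqP; rewrite eqn_mul2r expn_eq0 /= => /eqP [E].
  by congr (_, _); lia.
- move=> m /= /eqP bm; have m0 : (0 < m)%N.
    by case: m bm => //; rewrite bitcount0.
  have [k [i E]] := odd_part_exists m m0; exists (k, i) => //=.
  by split => //; move: bm; rewrite E bitcount_odd_part => -[->].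
Qed.

Lemma nneseries_le_bound (u : nat -> \bar R) (B : \bar R) : (forall n, 0 <= u n) ->
  (forall N, \sum_(0 <= i < N) u i <= B) -> \sum_(0 <= i <oo) u i <= B.
Proof.
move=> u0 H; apply: lime_le; first by apply: is_cvg_nneseries => k _ _; exact: u0.
exact: nearW.
Qed.

(** The weight is the measure of the node m rather than that of its cell, so for D > 0 this is twice
    the integral computed in [Lpint_stem]. *)
Definition chaos_mass p D (g : nat -> R[i]) : \bar R :=
  \sum_(0 <= m <oo | bitcount m == D) (2^-1 ^+ hlev m * cpow p (g m))%:E.

Lemma wmass_ge0 p (g : nat -> R[i]) m : (0 <= 2^-1 ^+ hlev m * cpow p (g m))%R.
Proof. by rewrite mulr_ge0 ?cpow_ge0 ?exprn_ge0 // invr_ge0. Qed.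

Lemma chaos_mass_ge0 p D g : 0 <= chaos_mass p D g.
Proof. by apply: nneseries_ge0 => m _ _; rewrite lee_fin wmass_ge0. Qed.

Lemma sum_chain p (g : nat -> R[i]) k N :
  (\sum_(i < N) 2^-1 ^+ hlev ((2 * k).+1 * 2 ^ i) * cpow p (g ((2 * k).+1 * 2 ^ i)%N)
   = 2^-1 ^+ hlev (2 * k).+1 * wsum p (fun i => g ((2 * k).+1 * 2 ^ i)%N) N)%R.
Proof.
rewrite /wsum mulr_sumr; apply: eq_bigr => i _.
by rewrite hlev_mul_exp // exprD mulrA.
Qed.

Lemma chaos_mass_dilconv p D a g (K : R) : (0 <= K)%R ->
  (forall b N, wsum p (cauchy_prod a b) N <= K * wsum p b N)%R ->
  chaos_mass p D.+1 (dilconv a g) <= K%:E * chaos_mass p D.+1 g.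
Proof.
have w0 (h : nat -> R[i]) m : 0 <= (2^-1 ^+ hlev m * cpow p (h m))%:E.
  by rewrite lee_fin wmass_ge0.
move=> K0 HK; rewrite /chaos_mass (nneseries_chain _ _ (w0 _)).
rewrite [in leRHS](nneseries_chain _ _ (w0 _)).
rewrite -nneseriesZl => [|k _]; last first.
  by apply: nneseries_ge0 => m _ _; rewrite lee_fin wmass_ge0.
apply: lee_nneseries => k _.
  by move=> _; apply: nneseries_ge0 => m _ _; rewrite lee_fin wmass_ge0.
apply: nneseries_le_bound => [m|N]; first by rewrite lee_fin wmass_ge0.
apply: (@le_trans _ _ (K%:E * \sum_(0 <= i < N)
   (2^-1 ^+ hlev ((2 * k).+1 * 2 ^ i) * cpow p (g ((2 * k).+1 * 2 ^ i)%N))%:E)); last first.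
  rewrite lee_wpmul2l ?lee_fin //; apply: nneseries_lim_ge => i _ _.
  by rewrite lee_fin wmass_ge0.
rewrite !sumEFin -EFinM lee_fin !big_mkord !sum_chain mulrCA.
rewrite ler_wpM2l ?exprn_ge0 ?invr_ge0 //.
rewrite (@eq_wsum _ _ _ (cauchy_prod a (fun i => g ((2 * k).+1 * 2 ^ i)%N))) // => i _.
exact: dilconv_chain.
Qed.

Lemma chaos_mass_trunc_cvg p D g : (0 < p)%R -> chaos_mass p D g < +oo ->
  (fun N => chaos_mass p D (fun k => if (k < N)%N then 0%R else g k)) @ \oo --> 0.
Proof.
move=> p0 fin; pose w m := (2^-1 ^+ hlev m * cpow p (g m))%:E.
rewrite [X in X @ _ --> _](_ : _ = fun N => \sum_(N <= k <oo | bitcount k == D) w k).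
  by apply: nneseries_tail_cvg => // m _; rewrite lee_fin wmass_ge0.
apply/funext => N; rewrite /w {fin}.
rewrite /chaos_mass [RHS]eseries_cond eseries_mkcond [RHS]eseries_mkcond.
apply: eq_eseriesr => k _; case: (bitcount k == D) => //=.
by case: ltnP => //= _; rewrite cpow0 // mulr0.
Qed.

End ChainSeries.

(** * Measures of nodes and integration over the partition into cells *)

Section NodeMeasure.
Context {R : realType}.
Local Notation mu := (@lebesgue_measure R).
Local Notation I := (`]0%R, 1%R]%classic : set R).

Lemma node_itv n : @node R n =
  `](hshift n)%:R / (2 ^+ hlev n), (hshift n).+1%:R / (2 ^+ hlev n)]%classic.
Proof. by rewrite set_itvE. Qed.

Lemma measurable_node n : measurable (@node R n).
Proof. by rewrite node_itv; exact: measurable_itv. Qed.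

Lemma node_measure n : mu (node n) = ((2^-1 : R) ^+ hlev n)%:E.
Proof.
rewrite node_itv lebesgue_measure_itv /= lte_fin ltr_pM2r ?invr_gt0 ?exprn_gt0 //.
by rewrite ltr_nat leqnn -EFinB -mulrBl -natr1 addrC addKr mul1r exprVn.
Qed.

Lemma node1_unit : @node R 1 = I.
Proof. by rewrite set_itvE; apply/seteqP; split => t /=; move/node1. Qed.

Lemma node_subset n : (0 < n)%N -> @node R n `<=` I.
Proof. by move=> n0 t /(node_sub n t n0) /=; rewrite in_itv. Qed.

Lemma cell_subset n : @cell R n `<=` I.
Proof. exact: node_subset. Qed.

Lemma node_splitU n : (0 < n)%N -> @node R n = node (2 * n)%N `|` cell n.
Proof. by move=> n0; apply/seteqP; split => t /=; move/(node_split n t n0). Qed.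

Lemma node_split_disj n : (0 < n)%N -> [disjoint @node R (2 * n)%N & cell n].
Proof.
move=> n0; apply/disj_setPS => t [/= l r]; exact: (node_left_right n t n0).
Qed.

(** Empty sets at the other indices turn the partition of order D into a family indexed by all n,
    the form in which countable additivity applies. *)
Definition level_cell D n : set R := if bitcount n == D then cell n else set0.

Lemma measurable_level_cell D n : measurable (level_cell D n).
Proof. by rewrite /level_cell; case: ifP => _ //; exact: measurable_node. Qed.

Lemma bigcup_level_cell D : I = \bigcup_n level_cell D n.
Proof.
apply/seteqP; split => [t /= It|t [n _]].
  have t01 : 0 < t <= 1 by move: It; rewrite in_itv.
  have [m [bm cm]] := cell_cover D t t01.
  by exists m => //; rewrite /level_cell bm eqxx.
by rewrite /level_cell; case: ifP => // _; exact: cell_subset.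
Qed.

Lemma trivIset_level_cell D : trivIset setT (level_cell D).
Proof.
move=> m n _ _ [t []]; rewrite /level_cell.
case: eqP => // bm cm; case: eqP => // bn cn.
by apply: cell_uniq cm cn _; rewrite bm bn.
Qed.

Lemma integral_level_cells D (g : R -> \bar R) : measurable_fun I g ->
  (forall t, I t -> (0 <= g t)%E) ->
  (\int[mu]_(t in I) g t =
   \sum_(0 <= n <oo | bitcount n == D) \int[mu]_(t in cell n) g t)%E.
Proof.
rewrite {1 2}(bigcup_level_cell D) => mg g0.
rewrite {1}(bigcup_level_cell D) ge0_integral_bigcup //.
- rewrite [RHS]eseries_mkcond; apply: eq_eseriesr => n _.
  by rewrite /level_cell; case: ifP => // _; rewrite integral_set0.
- exact: measurable_level_cell.
- exact: trivIset_level_cell.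
Qed.

Lemma stem_on_cell D n t : level_cell D n t -> stem D t = n.
Proof. by rewrite /level_cell; case: eqP => // <-; exact: stem_eq. Qed.

Lemma measurable_stem D (b : nat -> R) : measurable_fun I (fun t => b (stem D t)).
Proof.
rewrite (bigcup_level_cell D); apply/measurable_fun_bigcup => n.
  exact: measurable_level_cell.
apply: (eq_measurable_fun (cst (b n))); last exact: measurable_cst.
by move=> t /set_mem /stem_on_cell ->.
Qed.

Lemma Lpint_stem p D (b : nat -> R[i]) : Lpint p (fun t => b (stem D t)) =
  (\sum_(0 <= n <oo | bitcount n == D) (2^-1 ^+ hlev (2 * n).+1 * cpow p (b n))%:E)%E.
Proof.
rewrite /Lpint (integral_level_cells D).
- apply: eq_eseriesr => n /eqP bn.
  rewrite (@eq_integral _ _ _ _ _ (cst (cpow p (b n))%:E)) => [|t /set_mem ct]; last first.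
    by rewrite -bn (stem_eq _ _ ct).
  rewrite integral_cst; last exact: measurable_node.
  transitivity ((cpow p (b n))%:E * ((2^-1 : R) ^+ hlev (2 * n).+1)%:E)%E.
    by congr (_ * _)%E; exact: node_measure.
  by rewrite -EFinM mulrC.
- apply/measurable_EFinP; exact: (measurable_stem D (fun n => cpow p (b n))).
- by move=> t _; rewrite lee_fin powR_ge0.
Qed.

Lemma Lpint_stem_mass p D (b : nat -> R[i]) :
  (Lpint p (fun t => b (stem D.+1 t)) <= chaos_mass p D.+1 b)%E.
Proof.
rewrite Lpint_stem; apply: lee_nneseries => [n _ _|n /eqP bn].
  by rewrite lee_fin mulr_ge0 ?cpow_ge0 ?exprn_ge0 // invr_ge0.
have n0 : (0 < n)%N by case: n bn => //; rewrite bitcount0.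
rewrite lee_fin ler_wpM2r ?cpow_ge0 // hlev_doubleS // exprS.
by rewrite ger_pMl ?exprn_gt0 ?invr_gt0 // invf_le1 // ler1n.
Qed.

Lemma cpowE p (z : R[i]) : cpow p z = (cre z ^+ 2 + cim z ^+ 2) `^ (2^-1 * p).
Proof. by rewrite powRrM powR12_sqrt // addr_ge0 ?sqr_ge0. Qed.

Lemma measurable_cpow p D (u : R -> R[i]) :
  measurable_fun D (fun t => cre (u t)) -> measurable_fun D (fun t => cim (u t)) ->
  measurable_fun D (fun t => cpow p (u t)).
Proof.
move=> mre mim; under eq_fun do rewrite cpowE.
apply: (measurableT_comp (measurable_powR (2^-1 * p))).
by apply: measurable_funD; apply: measurable_funX.
Qed.

End NodeMeasure.

(** * Averages over nodes and Jensen's inequality *)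

Section NodeAverages.
Context {R : realType}.
Local Notation mu := (@lebesgue_measure R).
Local Notation I := (`]0%R, 1%R]%classic : set R).
Implicit Types (x : R -> R[i]) (p : R).

Lemma cabs_le_cpow p (z : R[i]) : 1 <= p -> cabs z <= 1 + cpow p z.
Proof.
move=> p1; have [z1|/ltW z1] := leP (cabs z) 1.
  by rewrite (le_trans z1) // lerDl cpow_ge0.
by rewrite (le_trans (le1r_powR z1 p1)) // lerDr.
Qed.

Lemma lebesgue_unit : mu I = 1%E.
Proof. by rewrite -node1_unit node_measure hlev1 expr0. Qed.

Lemma integrable_unit_cst (k : R) : mu.-integrable I (EFin \o cst k).
Proof.
apply/integrableP; split; first exact/measurable_EFinP/measurable_cst.
rewrite (@eq_integral _ _ _ _ _ (cst `|k|%:E)) //.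
by rewrite integral_cst //= lebesgue_unit mule1 ltry.
Qed.

Lemma inLp_integrable_cpow p x : inLp p x -> mu.-integrable I (EFin \o (fun t => cpow p (x t))).
Proof.
move=> [[mre mim] fin]; apply/integrableP; split.
  by apply/measurable_EFinP; exact: measurable_cpow.
rewrite (le_lt_trans _ fin) //; apply: ge0_le_integral => //.
- apply/measurable_EFinP; apply: measurableT_comp => //; exact: measurable_cpow.
- by apply/measurable_EFinP; exact: measurable_cpow.
by move=> t _ /=; rewrite lee_fin ger0_norm ?cpow_ge0.
Qed.

Lemma inLp_integrable_bound p x (u : R -> R) : 1 <= p -> inLp p x ->
  measurable_fun I u -> (forall t, `|u t| <= cabs (x t)) -> mu.-integrable I (EFin \o u).
Proof.
move=> p1 hx mu_ ux.
have := @le_integrable _ _ R mu I (measurable_itv _) (EFin \o u)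
  (EFin \o (fun t => 1 + cpow p (x t))).
apply.
- exact/measurable_EFinP.
- move=> t _ /=; rewrite lee_fin (ger0_norm (_ : 0 <= 1 + _)) ?addr_ge0 ?cpow_ge0 //.
  by rewrite (le_trans (ux t)) // cabs_le_cpow.
apply: (@integrableD _ _ _ mu I _ (EFin \o cst 1) (EFin \o (fun t => cpow p (x t)))) => //.
  exact: integrable_unit_cst.
exact: inLp_integrable_cpow.
Qed.

Lemma inLp_integrable_re p x : 1 <= p -> inLp p x -> mu.-integrable I (EFin \o (fun t => cre (x t))).
Proof.
move=> p1 hx; apply: (inLp_integrable_bound p x) => //; first by case: hx => -[].
by move=> t; exact: cabs_re.
Qed.

Lemma inLp_integrable_im p x : 1 <= p -> inLp p x -> mu.-integrable I (EFin \o (fun t => cim (x t))).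
Proof.
move=> p1 hx; apply: (inLp_integrable_bound p x) => //; first by case: hx => -[].
by move=> t; exact: cabs_im.
Qed.

Lemma node_integrable n (u : R -> R) : (0 < n)%N -> mu.-integrable I (EFin \o u) ->
  mu.-integrable (node n) (EFin \o u).
Proof.
move=> n0; apply: integrableS => //; first exact: measurable_node.
exact: node_subset.
Qed.

Lemma node_Rintegral_split n (u : R -> R) : (0 < n)%N -> mu.-integrable I (EFin \o u) ->
  \int[mu]_(t in node n) u t = \int[mu]_(t in node (2 * n)%N) u t + \int[mu]_(t in cell n) u t.
Proof.
move=> n0 iu; rewrite node_splitU // Rintegral_setU //.
- exact: measurable_node.
- exact: measurable_node.
- by rewrite -node_splitU //; exact: node_integrable.
- exact: node_split_disj.
Qed.

Definition node_avg x n : R[i] :=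
  (2 ^+ hlev n * \int[mu]_(t in node n) cre (x t)) +i*
  (2 ^+ hlev n * \int[mu]_(t in node n) cim (x t)).

Definition node_mass p x n : R := \int[mu]_(t in node n) cpow p (x t).

Lemma node_mass_ge0 p x n : 0 <= node_mass p x n.
Proof. by apply: Rintegral_ge0 => t _; exact: cpow_ge0. Qed.

Lemma node_mass_split p x n : inLp p x -> (0 < n)%N ->
  node_mass p x n = node_mass p x (2 * n)%N + node_mass p x (2 * n).+1.
Proof.
by move=> hx n0; apply: node_Rintegral_split => //; exact: inLp_integrable_cpow.
Qed.

Lemma node_avg_split p x n : 1 <= p -> inLp p x -> (0 < n)%N ->
  node_avg x (2 * n)%N + node_avg x (2 * n).+1 = node_avg x n *+ 2.
Proof.
move=> p1 hx n0; rewrite /node_avg hlev_double // hlev_doubleS //.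
have Er := node_Rintegral_split n _ n0 (inLp_integrable_re p x p1 hx).
have Ei := node_Rintegral_split n _ n0 (inLp_integrable_im p x p1 hx).
rewrite Er Ei mulr2n !exprS.
by apply/eqP; rewrite eq_complex /=; apply/andP; split; apply/eqP; rewrite /cell; ring.
Qed.

Lemma node_avg1 x : node_avg x 1 = cint x.
Proof. by rewrite /node_avg /cint hlev1 expr0 !mul1r node1_unit. Qed.

(** The graph of s^p lies above its tangent at s = r. It follows from Young's inequality for s and
    r^(p-1) with exponents p and p/(p-1). *)
Lemma young_tangent p (r s : R) : 1 < p -> 0 <= r -> 0 <= s ->
  p * (s * r `^ (p - 1)) <= s `^ p + (p - 1) * r `^ p.
Proof.
move=> p1 r0 s0; have p0 : 0 < p by lra.
pose q := p / (p - 1); have q0 : 0 < q by rewrite divr_gt0 // subr_gt0.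
have pq : p^-1 + q^-1 = 1.
  by rewrite /q invf_div -{1}[p^-1]mul1r -mulrDl addrC subrK divff // gt_eqF.
have := conjugate_powR s0 (powR_ge0 r (p - 1)) p0 q0 pq.
rewrite -powRrM mulrCA divff ?mulr1 ?subr_eq0 ?gt_eqF // => H.
apply: le_trans (ler_wpM2l (ltW p0) H) _.
rewrite mulrDr mulrCA divff ?gt_eqF // mulr1 lerD2l.
by rewrite mulrCA /q invf_div [p * _]mulrC divfK ?gt_eqF // mulrC.
Qed.

(* Jensen's inequality: integrate the tangent of [|z|^p] at the average. *)
Lemma cpow_node_avg_le p x n : 1 < p -> inLp p x -> (0 < n)%N ->
  2^-1 ^+ hlev n * cpow p (node_avg x n) <= node_mass p x n.
Proof.
move=> p1 hx n0; have p0 : 0 < p by lra.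
set w := node_avg x n; set r := cabs w; set m := 2^-1 ^+ hlev n.
have [r0|r0] := eqVneq r 0.
  by rewrite /cpow -/r r0 powR0 ?mulr0 ?node_mass_ge0 // gt_eqF.
have rp : 0 < r by rewrite lt_neqAle eq_sym r0 cabs_ge0.
(* The unit vector in the direction of the average w: the real functional a re z + b im z is at most
   |z|, with equality at z = w, which reduces the complex case to the scalar tangent of slope
   [k]. *)
pose a := cre w / r; pose b := cim w / r.
have ab : a ^+ 2 + b ^+ 2 = 1.
  rewrite /a /b !expr_div_n -mulrDl.
  have -> : cre w ^+ 2 + cim w ^+ 2 = r ^+ 2 by rewrite /r /cabs sqr_sqrtr // addr_ge0 ?sqr_ge0.
  by rewrite divff // expf_neq0.
have dot (z : R[i]) : a * cre z + b * cim z <= cabs z.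
  rewrite (le_trans (ler_norm _)) // -sqrtr_sqr ler_sqrt ?addr_ge0 ?sqr_ge0 //.
  rewrite -[leRHS]mul1r -ab -subr_ge0.
  have -> : (a ^+ 2 + b ^+ 2) * (cre z ^+ 2 + cim z ^+ 2) - (a * cre z + b * cim z) ^+ 2
     = (a * cim z - b * cre z) ^+ 2 by ring.
  exact: sqr_ge0.
pose k := p * r `^ (p - 1).
have k0 : 0 <= k by rewrite mulr_ge0 ?powR_ge0 // ltW.
have ire := node_integrable n _ n0 (inLp_integrable_re p x (ltW p1) hx).
have iim := node_integrable n _ n0 (inLp_integrable_im p x (ltW p1) hx).
have icp := node_integrable n _ n0 (inLp_integrable_cpow p x hx).
have icst (l : R) : mu.-integrable (node n) (EFin \o cst l).
  by apply: node_integrable => //; exact: integrable_unit_cst.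
have mn := measurable_node (R := R) n.
have izl l (u : R -> R) : mu.-integrable (node n) (EFin \o u) ->
    mu.-integrable (node n) (EFin \o (fun t => l * u t)).
  by move=> iu; exact: (@integrableZl _ _ R mu (node n) mn l _ iu).
have iD (u v : R -> R) : mu.-integrable (node n) (EFin \o u) ->
    mu.-integrable (node n) (EFin \o v) ->
    mu.-integrable (node n) (EFin \o (fun t => u t + v t)).
  by move=> iu iv; exact: (@integrableD _ _ R mu (node n) mn _ _ iu iv).
have cstE (l : R) : \int[mu]_(t in node n) l = l * m.
  by rewrite Rintegral_cst //; congr (_ * _); exact: (congr1 fine (node_measure n)).
have : \int[mu]_(t in node n) (k * a * cre (x t) + k * b * cim (x t)) <=
       \int[mu]_(t in node n) (cpow p (x t) + (p - 1) * r `^ p).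
  apply: le_Rintegral => //.
  - by apply: iD; apply: izl.
  - by apply: iD => //; exact: icst.
  move=> t _; apply: le_trans (young_tangent p r _ p1 (ltW rp) (cabs_ge0 (x t))).
  by have := ler_wpM2l k0 (dot (x t)); rewrite /k; lra.
rewrite RintegralD //; last exact: icst.
rewrite RintegralD //; [|by apply: izl|by apply: izl].
rewrite (cstE ((p - 1) * r `^ p)) 2?RintegralZl // -/(node_mass p x n).
have mE : m * 2 ^+ hlev n = 1 by rewrite /m exprVn mulVf // expf_neq0.
have -> : \int[mu]_(t in node n) cre (x t) = m * cre w by rewrite /= mulrA mE mul1r.
have -> : \int[mu]_(t in node n) cim (x t) = m * cim w by rewrite /= mulrA mE mul1r.
have wa : cre w = a * r by rewrite /a divfK.
have wb : cim w = b * r by rewrite /b divfK.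
have -> : k * a * (m * cre w) + k * b * (m * cim w) = p * (m * r `^ p).
  rewrite wa wb -(mulr_powRB1 (ltW rp) p0) /k.
  set y := r `^ (p - 1); transitivity ((a ^+ 2 + b ^+ 2) * (p * (m * (r * y)))); first by ring.
  by rewrite ab mul1r.
by rewrite /cpow -/r; set y := r `^ p; set v := node_mass p x n; clear; lra.
Qed.

End NodeAverages.

(** * Haar coefficients of an L^p function have finite mass in each chaos *)

Section DifferenceMass.
Context {R : realType}.
Local Notation mu := (@lebesgue_measure R).
Local Notation I := (`]0%R, 1%R]%classic : set R).
Implicit Types (x : R -> R[i]) (p : R).

Lemma Lpint_node_mass p x D : inLp p x -> Lpint p x =
  (\sum_(0 <= n <oo | bitcount n == D) (node_mass p x (2 * n).+1)%:E)%E.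
Proof.
move=> hx; rewrite /Lpint (integral_level_cells D).
- apply: eq_eseriesr => n _; rewrite /node_mass /Rintegral fineK //.
  have i := node_integrable (2 * n).+1 _ isT (inLp_integrable_cpow p x hx).
  have F := @integrable_fin_num _ _ R mu (node (2 * n).+1) (measurable_node _) _ i.
  exact: F.
- by apply/measurable_EFinP; case: hx => -[mre mim] _; exact: measurable_cpow.
- by move=> t _; rewrite lee_fin powR_ge0.
Qed.

Lemma Lpint_avg_le p x D : 1 < p -> inLp p x ->
  (Lpint p (fun t => node_avg x (2 * stem D t).+1) <= Lpint p x)%E.
Proof.
move=> p1 hx; rewrite (Lpint_node_mass p x D hx).
rewrite (Lpint_stem p D (fun n => node_avg x (2 * n).+1)).
apply: lee_nneseries => [n _ _|n _]; rewrite lee_fin.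
  by rewrite mulr_ge0 ?cpow_ge0 ?exprn_ge0 // invr_ge0.
exact: cpow_node_avg_le.
Qed.

Lemma node_mass_chain p x q N : inLp p x -> (0 < q)%N ->
  \sum_(i < N) node_mass p x (2 * (q * 2 ^ i)).+1 + node_mass p x (q * 2 ^ N)
  = node_mass p x q.
Proof.
move=> hx q0; elim: N => [|N IH]; first by rewrite big_ord0 add0r expn0 muln1.
rewrite big_ord_recr /= -[RHS]IH -addrA; congr (_ + _).
rewrite addrC [in RHS]node_mass_split ?muln_gt0 ?q0 ?expn_gt0 //.
by rewrite expnS mulnCA.
Qed.

Lemma node_mass_le p x q i : inLp p x -> (0 < q)%N -> node_mass p x (q * 2 ^ i) <= node_mass p x q.
Proof.
move=> hx q0; rewrite -(node_mass_chain p x q i hx q0) lerDr.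
by apply: sumr_ge0 => k _; exact: node_mass_ge0.
Qed.

(** This is the Haar coefficient 2^(hlev n) (x, h_n): the average over a node is the mean of those
    over its halves, so half of their difference is left average minus node average. *)
Definition node_diff x n : R[i] := node_avg x (2 * n)%N - node_avg x n.

(** The averages b over the disjoint cells are controlled by Jensen, the averages s over the nested
    nodes by [halving_bounded]. The cells contribute 2V, since they have half the measure of their
    nodes, and the last node V; this gives 3KV for s, and s - b costs the factor 2^p. *)
Lemma node_diff_chain_bound p : 1 < p -> exists2 K, 0 <= K & forall x q N,
  inLp p x -> (0 < q)%N ->
  2^-1 ^+ hlev q * wsum p (fun i => node_diff x (q * 2 ^ i)%N) N <= K * node_mass p x q.
Proof.
move=> p1; have p0 : 0 < p by lra.
have [K K0 HK] := halving_bounded p p1.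
exists (2 `^ p * (K * 3 + 2)) => [|x q N hx q0].
  by rewrite mulr_ge0 ?powR_ge0 // addr_ge0 // mulr_ge0.
set h := 2^-1 ^+ hlev q; set V := node_mass p x q.
pose s i := node_avg x (q * 2 ^ i)%N; pose b i := node_avg x (2 * (q * 2 ^ i)).+1.
have q2 i : (0 < q * 2 ^ i)%N by rewrite muln_gt0 q0 expn_gt0.
have sb i : s i *+ 2 = s i.+1 + b i.
  by rewrite /s /b -(node_avg_split p x _ (ltW p1) hx (q2 i)) expnS mulnCA.
have h0 : 0 <= h by rewrite exprn_ge0 // invr_ge0.
have bV : h * wsum p b N <= 2 * V.
  rewrite /V -(node_mass_chain p x q N hx q0) mulrDr -[leLHS]addr0 lerD //; last first.
    by rewrite mulr_ge0 // node_mass_ge0.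
  rewrite /wsum !mulr_sumr; apply: ler_sum => i _.
  have := cpow_node_avg_le p x (2 * (q * 2 ^ i)).+1 p1 hx isT.
  rewrite hlev_doubleS // hlev_mul_exp // exprS exprD -/h -/(b i).
  set u := cpow p _; set v := node_mass _ _ _; set w := _ ^+ i.
  by clear; lra.
have sV : h * (2^-1 ^+ N * cpow p (s N)) <= V.
  apply: le_trans (node_mass_le p x q N hx q0).
  by rewrite mulrA -exprD -hlev_mul_exp //; exact: cpow_node_avg_le.
have dE : wsum p (fun i => node_diff x (q * 2 ^ i)%N) N <= 2 `^ p * (wsum p s N + wsum p b N).
  rewrite /wsum -big_split /= mulr_sumr; apply: ler_sum => i _.
  rewrite -mulrDr mulrCA ler_wpM2l ?exprn_ge0 ?invr_ge0 //.
  have -> : node_diff x (q * 2 ^ i)%N = s i - b i.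
    rewrite /node_diff mulnCA -expnS -/(s i.+1) -/(s i); apply/eqP.
    by rewrite subr_eq addrAC eq_sym subr_eq -mulr2n sb.
  by rewrite (le_trans (cpow2_add_le _ _ _ p0)) // cpowN.
apply: le_trans (ler_wpM2l h0 dE) _.
rewrite mulrCA -[leRHS]mulrA ler_wpM2l ?powR_ge0 //.
have := ler_wpM2l h0 (HK b s N sb).
have := ler_wpM2l K0 bV; have := ler_wpM2l K0 sV; move: bV.
set y := wsum p s N; set z := wsum p b N; set w := 2^-1 ^+ N * _.
by clear; rewrite !mulrDr; lra.
Qed.

Lemma chaos_mass_diff_fin p x D : 1 < p -> inLp p x ->
  (chaos_mass p D.+1 (node_diff x) < +oo)%E.
Proof.
move=> p1 hx; have [K K0 HK] := node_diff_chain_bound p p1.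
apply: (@le_lt_trans _ _ (K%:E * Lpint p x)%E); last first.
  by case: hx => _; rewrite -ge0_fin_numE ?integral_ge0 // => [/fineK<-|t _];
     rewrite ?lee_fin ?powR_ge0 // -EFinM ltry.
(* The chains of order D+1 start at the nodes 2k+1, which are the cells of order D, so the bounds
   for single chains add up to a multiple of the integral over (0, 1]. *)
rewrite (Lpint_node_mass p x D hx) /chaos_mass nneseries_chain => [|m]; last first.
  by rewrite lee_fin wmass_ge0.
rewrite -nneseriesZl => [|n _]; last by rewrite lee_fin node_mass_ge0.
apply: lee_nneseries => [k _ _|k _].
  by apply: nneseries_ge0 => m _ _; rewrite lee_fin wmass_ge0.
apply: nneseries_le_bound => [m|N]; first by rewrite lee_fin wmass_ge0.
rewrite sumEFin -EFinM lee_fin big_mkord sum_chain.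
exact: HK.
Qed.

End DifferenceMass.

(** * Complex integrals and the pairings with g^n *)

Section ChaosCoefficients.
Context {R : realType}.
Local Notation mu := (@lebesgue_measure R).
Local Notation I := (`]0%R, 1%R]%classic : set R).
Implicit Types (x u v : R -> R[i]) (p : R).

Definition cintegrable u := mu.-integrable I (EFin \o (fun t => cre (u t))) /\
  mu.-integrable I (EFin \o (fun t => cim (u t))).

Lemma creD (z w : R[i]) : cre (z + w) = cre z + cre w. Proof. by case: z w => [a b] [c d]. Qed.
Lemma cimD (z w : R[i]) : cim (z + w) = cim z + cim w. Proof. by case: z w => [a b] [c d]. Qed.
Lemma creM (z w : R[i]) : cre (z * w) = cre z * cre w - cim z * cim w.
Proof. by case: z w => [a b] [c d]. Qed.
Lemma cimM (z w : R[i]) : cim (z * w) = cre z * cim w + cim z * cre w.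
Proof. by case: z w => [a b] [c d]. Qed.

Let mI : measurable I. Proof. exact: measurable_itv. Qed.

Let iZ (l : R) (f : R -> R) : mu.-integrable I (EFin \o f) ->
  mu.-integrable I (EFin \o (fun t => l * f t)).
Proof. by move=> fi; exact: (@integrableZl _ _ R mu I mI l _ fi). Qed.

Let iD (f g : R -> R) : mu.-integrable I (EFin \o f) -> mu.-integrable I (EFin \o g) ->
  mu.-integrable I (EFin \o (fun t => f t + g t)).
Proof. by move=> fi gi; exact: (@integrableD _ _ R mu I mI _ _ fi gi). Qed.

Let iB (f g : R -> R) : mu.-integrable I (EFin \o f) -> mu.-integrable I (EFin \o g) ->
  mu.-integrable I (EFin \o (fun t => f t - g t)).
Proof. by move=> fi gi; exact: (@integrableB _ _ R mu I mI _ _ fi gi). Qed.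

Lemma cintegrableD u v : cintegrable u -> cintegrable v -> cintegrable (fun t => u t + v t).
Proof.
move=> [ur ui] [vr vi]; rewrite /cintegrable; split.
  rewrite (_ : (fun t => cre _) = fun t => cre (u t) + cre (v t)); first exact: iD.
  by apply/funext => t; rewrite creD.
rewrite (_ : (fun t => cim _) = fun t => cim (u t) + cim (v t)); first exact: iD.
by apply/funext => t; rewrite cimD.
Qed.

Lemma cintegrableZ (a : R[i]) u : cintegrable u -> cintegrable (fun t => a * u t).
Proof.
move=> [ur ui]; rewrite /cintegrable; split.
  rewrite (_ : (fun t => cre _) = fun t => cre a * cre (u t) - cim a * cim (u t)).
    by apply: iB; exact: iZ.
  by apply/funext => t; rewrite creM.
rewrite (_ : (fun t => cim _) = fun t => cre a * cim (u t) + cim a * cre (u t)).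
  by apply: iD; exact: iZ.
by apply/funext => t; rewrite cimM.
Qed.

Lemma cintegrable0 : cintegrable (fun=> 0).
Proof. by split; exact: (integrable_unit_cst 0). Qed.

Lemma cint0 : cint (fun=> 0 : R[i]) = 0.
Proof. by rewrite /cint /= !Rintegral_cst // !mul0r. Qed.

Lemma cintD u v : cintegrable u -> cintegrable v ->
  cint (fun t => u t + v t) = cint u + cint v.
Proof.
move=> [ur ui] [vr vi]; rewrite /cint.
under eq_Rintegral do rewrite creD.
under [X in _ +i* X]eq_Rintegral do rewrite cimD.
by rewrite !RintegralD.
Qed.

Lemma cintZ (a : R[i]) u : cintegrable u -> cint (fun t => a * u t) = a * cint u.
Proof.
move=> [ur ui]; rewrite /cint.
under eq_Rintegral do rewrite creM.
under [X in _ +i* X]eq_Rintegral do rewrite cimM.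
rewrite RintegralB //; [|exact: iZ|exact: iZ].
rewrite RintegralD //; [|exact: iZ|exact: iZ].
rewrite !RintegralZl //; case: a => a b /=.
by apply/eqP; rewrite eq_complex /= !eqxx.
Qed.

Lemma cint_sum n (a : nat -> R[i]) (u : nat -> R -> R[i]) :
  (forall j, (j < n)%N -> cintegrable (u j)) ->
  cintegrable (fun t => \sum_(j < n) a j * u j t) /\
  cint (fun t => \sum_(j < n) a j * u j t) = \sum_(j < n) a j * cint (u j).
Proof.
elim: n => [|n IH] ui.
  have E : (fun t => \sum_(j < 0) a j * u j t) = fun=> 0 by apply/funext => t; rewrite big_ord0.
  by rewrite E big_ord0 cint0; split=> //; exact: cintegrable0.
have [i1 e1] := IH (fun j jn => ui j (ltnW jn)).
have E : (fun t => \sum_(j < n.+1) a j * u j t) =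
    fun t => \sum_(j < n) a j * u j t + a n * u n t.
  by apply/funext => t; rewrite big_ord_recr.
have i2 := cintegrableZ (a n) (u n) (ui n (ltnSn n)).
rewrite E big_ord_recr /= cintD // e1 cintZ; last exact: ui.
by split=> //; exact: cintegrableD.
Qed.

Lemma Rintegral_indic_diff n (f : R -> R) : (0 < n)%N -> mu.-integrable I (EFin \o f) ->
  mu.-integrable I (EFin \o (fun t => f t * (\1_(node (2 * n)%N) t - \1_(cell n) t))) /\
  \int[mu]_(t in I) (f t * (\1_(node (2 * n)%N) t - \1_(cell n) t)) =
  \int[mu]_(t in node (2 * n)%N) f t - \int[mu]_(t in cell n) f t.
Proof.
move=> n0 fi.
have sub k : (0 < k)%N -> mu.-integrable I (EFin \o (fun t => f t * \1_(node k) t)) /\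
    \int[mu]_(t in I) (f t * \1_(node k) t) = \int[mu]_(t in node k) f t.
  move=> k0; have -> : (fun t => f t * \1_(node k) t) = f \_ (node k).
    by rewrite patch_indic.
  split; last first.
    rewrite -Rintegral_mkcondr; congr (Rintegral mu _ f).
    by apply: setIidr; exact: node_subset.
  apply: (@le_integrable _ _ R mu I mI _ (EFin \o f)) => //.
    apply/measurable_EFinP; rewrite patch_indic; apply: measurable_funM.
      by apply/measurable_EFinP; case/integrableP: fi.
    by apply: measurable_indic; exact: measurable_node.
  move=> t _ /=; rewrite patch_indic /= lee_fin normrM indicE.
  by case: (t \in _); rewrite ?normr1 ?mulr1 ?normr0 ?mulr0.
have [i1 e1] := sub (2 * n)%N ltac:(by rewrite muln_gt0 n0).
have [i2 e2] := sub (2 * n).+1 isT.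
under [X in _.-integrable _ (EFin \o X)]eq_fun do rewrite mulrBr.
under eq_Rintegral do rewrite mulrBr.
by split; [exact: iB | rewrite RintegralB // e1 e2].
Qed.

Lemma cre_mul_real (z : R[i]) (r : R) : cre (z * r%:C) = cre z * r.
Proof. by rewrite creM /= mulr0 subr0. Qed.

Lemma cim_mul_real (z : R[i]) (r : R) : cim (z * r%:C) = cim z * r.
Proof. by rewrite cimM /= mulr0 add0r. Qed.

Lemma cint_mul_haar p x n : 1 <= p -> inLp p x -> (0 < n)%N ->
  cintegrable (fun t => x t * haar n t) /\
  (2 ^ hlev n)%:R * cint (fun t => x t * haar n t) = node_diff x n.
Proof.
move=> p1 hx n0.
have [ir er] := Rintegral_indic_diff n _ n0 (inLp_integrable_re p x p1 hx).
have [ii ei] := Rintegral_indic_diff n _ n0 (inLp_integrable_im p x p1 hx).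
have -> : (fun t => x t * haar n t) =
    fun t => x t * (\1_(node (2 * n)%N) t - \1_(cell n) t)%:C.
  by apply/funext => t; rewrite haarE.
split.
  rewrite /cintegrable; split.
    rewrite (_ : (fun t => cre _) =
      fun t => cre (x t) * (\1_(node (2 * n)%N) t - \1_(cell n) t)) //.
    by apply/funext => t; rewrite cre_mul_real.
  rewrite (_ : (fun t => cim _) =
    fun t => cim (x t) * (\1_(node (2 * n)%N) t - \1_(cell n) t)) //.
  by apply/funext => t; rewrite cim_mul_real.
rewrite /cint.
under eq_Rintegral do rewrite cre_mul_real.
under [X in _ +i* X]eq_Rintegral do rewrite cim_mul_real.
rewrite er ei.
have S2 : node_diff x n *+ 2 = node_avg x (2 * n)%N - node_avg x (2 * n).+1.
  rewrite /node_diff mulrnBl -(node_avg_split p x n p1 hx n0) mulr2n opprD.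
  by rewrite addrACA subrr add0r.
have two : (2 : R[i]) != 0 by rewrite pnatr_eq0.
apply: (mulIf two); rewrite [RHS]mulr_natr S2 /node_avg hlev_double // hlev_doubleS //.
rewrite natrX !exprS.
have -> : (2 : R[i]) = (2 : R)%:C by rewrite rmorph_nat.
rewrite -rmorphXn /=; apply/eqP; rewrite eq_complex /=.
by apply/andP; split; apply/eqP; rewrite /cell; ring.
Qed.

(** The factor 2^(m-j) in g^n is 2 to the level of n / 2^j, exactly the normalisation that turns (x,
    h_(n/2^j)) into [node_diff]. *)
Lemma pairing_gfun p x (d : nat -> R[i]) n : 1 <= p -> inLp p x -> (0 < n)%N ->
  pairing x (gfun d n) = dilconv d (node_diff x) n.
Proof.
move=> p1 hx /odd_part_exists[k [i ->]]; set q := (2 * k).+1.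
rewrite /pairing /gfun /dilconv logn_odd_part.
have E j : (j < i.+1)%N -> (q * 2 ^ i %/ 2 ^ j = q * 2 ^ (i - j))%N.
  by move=> ji; rewrite divn_odd_part.
have q0 j : (0 < q * 2 ^ (i - j))%N by rewrite muln_gt0 expn_gt0.
pose u j t := x t * haar (q * 2 ^ (i - j)) t.
pose a j : R[i] := d j * (2 ^ hlev (q * 2 ^ (i - j)))%:R.
have ui j : (j < i.+1)%N -> cintegrable (u j).
  by move=> _; have [] := cint_mul_haar p x _ p1 hx (q0 j).
have [_ ] := cint_sum i.+1 a u ui.
rewrite -[X in cint X = _ -> _](_ : (fun t => x t * \sum_(j < i.+1)
   d j * (2 ^ (hlev (q * 2 ^ i) - j))%:R * haar (q * 2 ^ i %/ 2 ^ j) t) = _); last first.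
  apply/funext => t; rewrite mulr_sumr; apply: eq_bigr => j _.
  rewrite E // mulrCA /u /a; congr (_ * (2 ^ _)%:R * _).
  by rewrite !hlev_mul_exp // addnBA // -ltnS.
move=> ->; apply: eq_bigr => j _; rewrite E // /a -mulrA; congr (_ * _).
by have [_ ->] := cint_mul_haar p x _ p1 hx (q0 j).
Qed.

End ChaosCoefficients.

(** * Almost everywhere convergence of the averages *)

Section AverageConvergence.
Context {R : realType}.
Local Notation mu := (@lebesgue_measure R).
Local Notation I := (`]0%R, 1%R]%classic : set R).
Implicit Types (x : R -> R[i]) (p : R).

(** A positive limit is handled by differentiability of the power; the limit 0 is treated
    directly. *)
Lemma cvg_powR_ge0 (q s : R) (u : nat -> R) : 0 < q -> (forall n, 0 <= u n) ->
  u @ \oo --> s -> (fun n => u n `^ q) @ \oo --> s `^ q.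
Proof.
move=> q0 u0 us.
have s0 : 0 <= s.
  have <- : limn u = s by apply: cvg_lim.
  by apply: limr_ge; [exact: (cvgP s) | exact: nearW].
have [s0'|sN0] := eqVneq s 0; last first.
  have sp : 0 < s by rewrite lt_neqAle eq_sym sN0.
  have C : {for s, continuous (fun a => a `^ q)}.
    apply: differentiable_continuous; apply/derivable1_diffP.
    by apply: derivable_powR; rewrite in_itv /= sp.
  exact: (cvg_comp _ _ us C).
rewrite s0' powR0 ?gt_eqF //; rewrite s0' in us.
apply/cvgrPdist_lt => e e0; have e1 : 0 < e `^ q^-1 by rewrite powR_gt0.
move/cvgrPdist_lt : us => /(_ _ e1); apply: filterS => n /=.
rewrite !sub0r !normrN !ger0_norm ?powR_ge0 // => H.
rewrite [ltRHS](_ : e = (e `^ q^-1) `^ q).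
  by rewrite gt0_ltr_powR ?nnegrE // ltW.
by rewrite -powRrM mulVf ?gt_eqF // powRr1 // ltW.
Qed.

Lemma cvg_cpow p (a : nat -> R[i]) (z : R[i]) : 0 < p ->
  (fun n => cre (a n)) @ \oo --> cre z -> (fun n => cim (a n)) @ \oo --> cim z ->
  (fun n => cpow p (a n)) @ \oo --> cpow p z.
Proof.
move=> p0 ar ai; under eq_fun do rewrite cpowE; rewrite cpowE.
apply: cvg_powR_ge0 => [|n|]; first by rewrite mulr_gt0 // invr_gt0.
  by rewrite addr_ge0 ?sqr_ge0.
by apply: cvgD; rewrite expr2; under eq_fun do rewrite expr2; exact: cvgM.
Qed.

Lemma hlev_stem D (t : R) : 0 < t <= 1 -> (D <= hlev (2 * stem D t).+1)%N.
Proof.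
move=> t01; elim: D => // D IH; have [i ->] := stemS D t t01.
rewrite hlev_doubleS ?muln_gt0 ?expn_gt0 // hlev_mul_exp // ltnS.
by rewrite (leq_trans IH) // leq_addr.
Qed.

(** The balls are a default outside (0, 1]: the differentiation theorem takes a nicely shrinking
    family at every real t. *)
Definition shrink_set (t : R) (n : nat) : set R :=
  if (0 < t) && (t <= 1) then cell (stem n t) else ball t (2^-1 ^+ n).

Lemma node_ball n (t : R) : node n t -> node n `<=` ball t (2^-1 ^+ hlev n).
Proof.
move=> /nodeE/andP[t0 t1] y /nodeE/andP[y0 y1].
have L0 : 0 < (2 : R) ^+ hlev n by rewrite exprn_gt0.
rewrite -ball_normE /= exprVn -(ltr_pM2l L0) divff ?gt_eqF //.
rewrite -[X in X * _]gtr0_norm // -normrM mulrBr ltr_norml.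
by rewrite -natr1 in t1 y1; apply/andP; split; lra.
Qed.

Lemma cvg_half_exp : (fun n => (2^-1 : R) ^+ n) @ \oo --> 0.
Proof. by apply: cvg_expr; rewrite ger0_norm ?invr_ge0 // invf_lt1 // ltr1n. Qed.

Lemma shrink_set_nicely t : nicely_shrinking t (shrink_set t).
Proof.
split=> [n|]; first by rewrite /shrink_set; case: ifP => _; [exact: measurable_node|exact: measurable_ball].
have pos k : 0 < (2^-1 : R) ^+ k by rewrite exprn_gt0 // invr_gt0.
have [t01|t01] := boolP ((0 < t) && (t <= 1)); last first.
  exists (1, fun n => PosNum (pos n)); split => //=.
  - exact: cvg_half_exp.
  - by move=> n; rewrite /shrink_set (negbTE t01).
  - by move=> n; rewrite /shrink_set (negbTE t01) mul1e.
pose l n := hlev (2 * stem n t).+1.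
(* The cell lies in the ball around t whose radius is the length of the cell; the ball is twice as
   long, hence the constant 2. The radii tend to 0 by [hlev_stem]. *)
exists (2, fun n => PosNum (pos (l n))); split => //=.
- have B : \forall n \near \oo, cst 0 n <= (2^-1 : R) ^+ l n <= 2^-1 ^+ n.
    apply: nearW => n; rewrite /= ltW //= ler_wiXn2l ?invr_ge0 ?invf_le1 ?ler1n //.
    exact: hlev_stem.
  exact: (squeeze_cvgr B (cvg_cst _) cvg_half_exp).
- move=> n; rewrite /shrink_set t01; apply: node_ball.
  by have [_ +] := stemP n t t01.
- move=> n; rewrite /shrink_set t01 lebesgue_measure_ball /=; last exact: ltW.
  rewrite /cell (node_measure (2 * stem n t).+1) -EFinM.
  by rewrite lee_fin mulr_natl.
Qed.

Lemma ae_average_cvg (f : R -> R) : mu.-integrable I (EFin \o f) ->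
  \forall t \ae mu, I t -> (fun M => 2 ^+ hlev (2 * stem M t).+1 *
    \int[mu]_(s in cell (stem M t)) f s) @ \oo --> f t.
Proof.
move=> fi; have mI : measurable I by exact: measurable_itv.
have locf := integrable_locally_restrict mI fi.
have := lebesgue_differentiation locf.
apply: (@filterS _ _ (ae_filter_ringOfSetsType mu)) => t Lt It.
have t01 : (0 < t) && (t <= 1) by move: It; rewrite /= in_itv.
have := nice_lebesgue_differentiation shrink_set_nicely locf Lt.
rewrite patchE mem_set // => /fine_cvg; apply: cvg_trans; apply: near_eq_cvg.
apply: nearW => M; rewrite /= /shrink_set t01.
set n := (2 * stem M t).+1.
have -> : (\int[mu]_(y in cell (stem M t)) ((f \_ I) y)%:E =
          (\int[mu]_(s in cell (stem M t)) f s)%:E)%E.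
  rewrite /Rintegral fineK.
    apply: eq_integral => s /set_mem cs; rewrite patchE mem_set //.
    exact: cell_subset cs.
  exact: (@integrable_fin_num _ _ R mu (node n) (measurable_node _) _ (node_integrable n f isT fi)).
have -> : (mu (cell (stem M t)))^-1%E = (2 ^+ hlev n)%:E.
  transitivity ((((2^-1 : R) ^+ hlev n)%:E)^-1)%E.
    by congr (_^-1)%E; exact: node_measure.
  by rewrite inver ifF ?exprVn ?invrK // gt_eqF // invr_gt0 exprn_gt0.
by [].
Qed.

Lemma ae_node_avg_cvg p x : 1 <= p -> inLp p x ->
  \forall t \ae mu, I t ->
   (fun M => cre (node_avg x (2 * stem M t).+1)) @ \oo --> cre (x t) /\
   (fun M => cim (node_avg x (2 * stem M t).+1)) @ \oo --> cim (x t).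
Proof.
move=> p1 hx; have := ae_average_cvg _ (inLp_integrable_re p x p1 hx).
have := ae_average_cvg _ (inLp_integrable_im p x p1 hx).
by apply: (@filterS2 _ _ (ae_filter_ringOfSetsType mu)) => t H1 H2 It; split; [exact: H2|exact: H1].
Qed.

End AverageConvergence.

(** * From almost everywhere convergence to convergence in L^p *)

Section LpConvergence.
Context {R : realType}.
Local Notation mu := (@lebesgue_measure R).
Local Notation I := (`]0%R, 1%R]%classic : set R).
Implicit Types (x : R -> R[i]) (p : R).

(** Fatou's lemma bounds B by the lower limit of the integrals of [phi n], which are at most B - e
    n; so the nonnegative e n cannot stay away from 0. *)
Lemma fatou_deficit_cvg0 (phi : nat -> R -> R) (F : R -> R) (e : nat -> R) (B : R) :
  (forall n, measurable_fun I (phi n)) -> measurable_fun I F ->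
  (forall n t, 0 <= phi n t) -> (forall t, 0 <= F t) -> (forall n, 0 <= e n) ->
  (\forall t \ae mu, I t -> phi ^~ t @ \oo --> F t) ->
  (\int[mu]_(t in I) (F t)%:E = B%:E)%E ->
  (forall n, \int[mu]_(t in I) (phi n t)%:E <= (B - e n)%:E)%E ->
  e @ \oo --> 0.
Proof.
move=> mphi mF phi0 F0 e0 cvgphi FB phiB.
have mI : measurable I by exact: measurable_itv.
pose u n := (\int[mu]_(t in I) (phi n t)%:E)%E.
have Bu : (B%:E <= limn_einf u)%E.
  have mE n : measurable_fun I (fun t => (phi n t)%:E) by exact/measurable_EFinP.
  have E0 n t : I t -> (0 <= (phi n t)%:E)%E by rewrite lee_fin.
  apply: le_trans (@fatou _ _ R mu I mI (fun n t => (phi n t)%:E) mE E0).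
  rewrite -FB; apply: (@ae_ge0_le_integral _ _ R mu I mI).
  - by move=> t _; rewrite lee_fin.
  - exact/measurable_EFinP.
  - move=> t _; rewrite limn_einf_lim; apply: lime_ge.
      by apply/cvg_ex; eexists; apply/ereal_nondecreasing_cvgn; exact: nondecreasing_einfs.
    by apply: nearW => n; apply: le_ereal_inf_tmp => _ [k _ <-]; rewrite lee_fin.
  - have me : measurable_fun I (fun t => limn_esup (fun n => (- phi n t)%:E)).
      apply: measurable_fun_limn_esup => n; apply/measurable_EFinP.
      by apply: measurableT_comp.
    suff : measurable_fun I (fun t => - limn_esup (fun n => (- phi n t)%:E))%E by [].
    by apply: measurableT_comp.
  apply: (@filterS _ _ (ae_filter_ringOfSetsType mu)) cvgphi => t H It.
  have C : (fun n => (phi n t)%:E) @ \oo --> (F t)%:E.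
    by apply: cvg_EFin; [exact: nearW | exact: H].
  by rewrite (cvg_limn_einf_sup C).1.
apply/cvgrPdist_lt => eps eps0.
have : ((B - eps)%:E < limn_einf u)%E.
  by apply: lt_le_trans Bu; rewrite lte_fin ltrBlDr ltrDl.
rewrite limn_einf_lim.
have /cvg_lim -> // := ereal_nondecreasing_cvgn (@nondecreasing_einfs _ u).
move=> /ereal_sup_gt[_ [n _ <-]] Hn.
exists n => // k /= nk; rewrite sub0r normrN ger0_norm //.
have : ((B - eps)%:E < (B - e k)%:E)%E.
  apply: lt_le_trans Hn _; apply: le_trans (phiB k).
  by apply: ereal_inf_lbound; exists k.
by rewrite lte_fin ltrD2l ltrN2.
Qed.

Lemma EFin_Rintegral (f : R -> R) : mu.-integrable I (EFin \o f) ->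
  (\int[mu]_(t in I) (f t)%:E)%E = (\int[mu]_(t in I) f t)%:E.
Proof.
move=> fi; rewrite /Rintegral fineK //.
exact: (@integrable_fin_num _ _ R mu I (measurable_itv _) _ fi).
Qed.

Lemma inLp_stem p D (b : nat -> R[i]) :
  (Lpint p (fun t => b (stem D t)) < +oo)%E -> inLp p (fun t => b (stem D t)).
Proof.
by move=> fin; split=> //; split; [exact: (measurable_stem D (fun n => cre (b n)))
                                  |exact: (measurable_stem D (fun n => cim (b n)))].
Qed.

Lemma inLpB p x y : 0 < p -> inLp p x -> inLp p y -> inLp p (fun t => x t - y t).
Proof.
move=> p0 hx hy.
have mre : measurable_fun I (fun t => cre (x t - y t)).
  have -> : (fun t => cre (x t - y t)) = fun t => cre (x t) - cre (y t).
    by apply/funext => t; case: (x t) (y t) => a b [c d].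
  by case: hx hy => -[? ?] _ [[? ?] _]; exact: measurable_funB.
have mim : measurable_fun I (fun t => cim (x t - y t)).
  have -> : (fun t => cim (x t - y t)) = fun t => cim (x t) - cim (y t).
    by apply/funext => t; case: (x t) (y t) => a b [c d].
  by case: hx hy => -[? ?] _ [[? ?] _]; exact: measurable_funB.
split=> //.
have mI : measurable I by exact: measurable_itv.
have bi : mu.-integrable I (EFin \o (fun t => 2 `^ p * (cpow p (x t) + cpow p (y t)))).
  apply: (@integrableZl _ _ R mu I mI (2 `^ p) (EFin \o (fun t => cpow p (x t) + cpow p (y t)))).
  exact: (@integrableD _ _ R mu I mI _ _ (inLp_integrable_cpow p x hx) (inLp_integrable_cpow p y hy)).
have : mu.-integrable I (EFin \o (fun t => cpow p (x t - y t))).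
  have := @le_integrable _ _ R mu I mI (EFin \o (fun t => cpow p (x t - y t))) _ _ _ bi.
  apply; first by apply/measurable_EFinP; exact: measurable_cpow.
  move=> t _ /=; rewrite lee_fin !ger0_norm ?cpow_ge0 //.
    by rewrite (le_trans (cpow2_add_le _ _ _ p0)) // cpowN.
  by rewrite mulr_ge0 ?powR_ge0 // addr_ge0 // cpow_ge0.
move=> /integrableP[_]; apply: le_lt_trans; apply: ge0_le_integral => //.
- by move=> t _; rewrite lee_fin powR_ge0.
- by apply/measurable_EFinP; exact: measurable_cpow.
- by apply/measurable_EFinP; apply: measurableT_comp => //; exact: measurable_cpow.
by move=> t _ /=; rewrite lee_fin ler_norm.
Qed.

Lemma Lp_cvg_node_avg p x : 1 < p -> inLp p x ->
  Lp_cvg p (fun M t => node_avg x (2 * stem M t).+1) x.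
Proof.
move=> p1 hx; have p0 : 0 < p by lra.
pose A M (t : R) := node_avg x (2 * stem M t).+1.
have leA M : (Lpint p (A M) <= Lpint p x)%E by exact: Lpint_avg_le.
have hA M : inLp p (A M).
  apply: (inLp_stem p M (fun n => node_avg x (2 * n).+1)).
  by apply: le_lt_trans (leA M) _; case: hx.
have hAx M := inLpB p _ _ p0 (hA M) hx.
have iA M := inLp_integrable_cpow p _ (hA M).
have ix := inLp_integrable_cpow p _ hx.
have iAx M := inLp_integrable_cpow p _ (hAx M).
have mI : measurable I by exact: measurable_itv.
pose K : R := 2 `^ p; have K0 : 0 <= K by exact: powR_ge0.
pose X := \int[mu]_(t in I) cpow p (x t).
pose e M := \int[mu]_(t in I) cpow p (A M t - x t).
have LE M : Lpint p (fun t => A M t - x t) = (e M)%:E by exact: (EFin_Rintegral _ (iAx M)).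
have AX M : \int[mu]_(t in I) cpow p (A M t) <= X.
  have LA : Lpint p (A M) = (\int[mu]_(t in I) cpow p (A M t))%:E.
    exact: (EFin_Rintegral _ (iA M)).
  have LX : Lpint p x = X%:E by exact: (EFin_Rintegral _ ix).
  by have := leA M; rewrite LA LX lee_fin.
suff : e @ \oo --> 0.
  move=> e0; rewrite /Lp_cvg (_ : (fun M => _) = EFin \o e).
    by apply: cvg_EFin => //; exact: nearW.
  by apply/funext => M; exact: LE.
have iZ (l : R) (f : R -> R) : mu.-integrable I (EFin \o f) ->
  mu.-integrable I (EFin \o (fun t => l * f t)).
  by move=> fi; exact: (@integrableZl _ _ R mu I mI l _ fi).
have iD (f g : R -> R) : mu.-integrable I (EFin \o f) -> mu.-integrable I (EFin \o g) ->
  mu.-integrable I (EFin \o (fun t => f t + g t)).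
  by move=> fi gi; exact: (@integrableD _ _ R mu I mI _ _ fi gi).
have iB (f g : R -> R) : mu.-integrable I (EFin \o f) -> mu.-integrable I (EFin \o g) ->
  mu.-integrable I (EFin \o (fun t => f t - g t)).
  by move=> fi gi; exact: (@integrableB _ _ R mu I mI _ _ fi gi).
(* Nonnegative by [cpow2_add_le], and convergent almost everywhere to 2K |x|^p. As Jensen gives the
   averages a p-th power integral of at most X, the integral of [phi M] is at most 2KX - e M, so the
   error is the deficit in Fatou's lemma. *)
pose phi M (t : R) := K * (cpow p (A M t) + cpow p (x t)) - cpow p (A M t - x t).
have iphi M : mu.-integrable I (EFin \o phi M).
  by apply: iB => //; apply: iZ; exact: iD.
have mint (f : R -> R) : mu.-integrable I (EFin \o f) -> measurable_fun I f.
  by case/integrableP => mf _; exact/measurable_EFinP.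
apply: (fatou_deficit_cvg0 phi (fun t => K * (cpow p (x t) + cpow p (x t))) e (K * (X + X))).
- by move=> M; exact: mint.
- by apply: mint; apply: iZ; exact: iD.
- move=> M t; rewrite subr_ge0 (le_trans (cpow2_add_le _ _ _ p0)) //.
  by rewrite cpowN.
- by move=> t; rewrite mulr_ge0 // addr_ge0 // cpow_ge0.
- by move=> M; apply: Rintegral_ge0 => t _; exact: cpow_ge0.
- have := ae_node_avg_cvg p x (ltW p1) hx.
  apply: (@filterS _ _ (ae_filter_ringOfSetsType mu)) => t H It; have [Hr Hi] := H It.
  have cA : (fun M => cpow p (A M t)) @ \oo --> cpow p (x t) by exact: cvg_cpow.
  have cAx : (fun M => cpow p (A M t - x t)) @ \oo --> 0.
    rewrite -(cpow0 p p0); apply: cvg_cpow => //=.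
      rewrite (_ : (fun M => _) = fun M => cre (A M t) - cre (x t)).
        by rewrite -(subrr (cre (x t))); apply: cvgB => //; exact: cvg_cst.
      by apply/funext => M; case: (A M t) (x t) => a b [c d].
    rewrite (_ : (fun M => _) = fun M => cim (A M t) - cim (x t)).
      by rewrite -(subrr (cim (x t))); apply: cvgB => //; exact: cvg_cst.
    by apply/funext => M; case: (A M t) (x t) => a b [c d].
  rewrite -[X in _ --> X]subr0; apply: cvgB => //.
  by apply: cvgM; [exact: cvg_cst | apply: cvgD => //; exact: cvg_cst].
- rewrite EFin_Rintegral; last by apply: iZ; exact: iD.
  by rewrite RintegralZl //; [rewrite RintegralD | exact: iD].
move=> M; rewrite EFin_Rintegral // lee_fin /phi RintegralB //; last by apply: iZ; exact: iD.
rewrite lerD2r RintegralZl //; last exact: iD.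
have ID : \int[mu]_(t in I) (cpow p (A M t) + cpow p (x t)) =
    \int[mu]_(t in I) cpow p (A M t) + X.
  exact: (@RintegralD _ _ R mu I _ _ mI (iA M) ix).
rewrite ID; apply: ler_wpM2l; first exact: K0.
by apply: lerD; [exact: AX | exact: lexx].
Qed.

End LpConvergence.

(** * Convergence inside one chaos and the final assembly *)

Section ChaosConvergence.
Context {R : realType}.

Lemma eq_Lpint p (u v : R -> R[i]) :
  (forall t, 0 < t <= 1 -> cpow p (u t) = cpow p (v t)) -> Lpint p u = Lpint p v.
Proof.
move=> uv; apply: eq_integral => t /set_mem; rewrite /= in_itv /= => t01.
by congr EFin; exact: uv.
Qed.

Lemma eq_Lp_cvg p (s s' : nat -> R -> R[i]) (x : R -> R[i]) :
  (forall N t, 0 < t <= 1 -> s N t = s' N t) -> Lp_cvg p s x -> Lp_cvg p s' x.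
Proof.
move=> ss'; rewrite /Lp_cvg; apply: cvg_trans; apply: near_eq_cvg.
by apply: nearW => N; apply: eq_Lpint => t t01; rewrite ss'.
Qed.

Lemma chaos_component_cvg p D (f : R -> R[i]) (phi eta : nat -> R[i]) (K : R) :
  0 < p -> (forall i t, cell (2 ^ i) t -> f t = phi i) -> 0 <= K ->
  (forall b N, wsum p (cauchy_prod phi b) N <= K * wsum p b N) ->
  (chaos_mass p D.+1 eta < +oo)%E ->
  Lp_cvg p (fun N t => \sum_(1 <= n < N | bitcount n == D.+1) eta n * dil f n t)
    (fun t => dilconv phi eta (stem D.+1 t)).
Proof.
move=> p0 Hf K0 HK fin.
pose tail N k : R[i] := if (k < N)%N then 0 else eta k.
have Lp0 (u : R -> R[i]) : (0 <= Lpint p u)%E.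
  by apply: integral_ge0 => t _; rewrite lee_fin powR_ge0.
have bound N : (Lpint p (fun t =>
    ((\sum_(1 <= n < N | bitcount n == D.+1) eta n * dil f n t)
    - dilconv phi eta (stem D.+1 t))%R) <= K%:E * chaos_mass p D.+1 (tail N))%E.
  rewrite (eq_Lpint p _ (fun t => dilconv phi (tail N) (stem D.+1 t))).
    apply: le_trans (chaos_mass_dilconv p D phi (tail N) K K0 HK).
    exact: (Lpint_stem_mass p D (dilconv phi (tail N))).
  move=> t t01; rewrite (partial_sum_stem f phi eta D.+1 N t Hf) // -dilconvB -cpowN.
  congr cpow; rewrite /dilconv -sumrN; apply: eq_bigr => j _.
  by rewrite -mulrN /tail; case: ifP => _; rewrite ?subrr ?oppr0 // sub0r opprK.
have cv : (fun N => K%:E * chaos_mass p D.+1 (tail N))%E @ \oo --> 0%E.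
  rewrite -(mule0 K%:E); apply: cvgeZl => //.
  exact: chaos_mass_trunc_cvg.
apply: (squeeze_cvge _ (cvg_cst 0%E) cv).
by apply: nearW => N; rewrite Lp0 bound.
Qed.

End ChaosConvergence.

Theorem theorem4 (R : realType) (p : R) (c d : nat -> R[i]) (f : R -> R[i]) :
  1 < p ->
  (* f is the first-order Haar chaos sum_k c_k h_{2^k} (pointwise, the sum is
     finite at every t in (0,1]) *)
  (forall t : R, 0 < t <= 1 -> exists N0 : nat, forall N : nat, (N0 <= N)%N ->
      f t = \sum_(k < N) c k * haar (2 ^ k) t) ->
  inLp p f ->
  (* \hat f in M_p^+(D_{2^{-1/p}}) *)
  Mp p (2 `^ (- p^-1)) c ->
  (* d = Taylor coefficients of 1/\hat f, and 1/\hat f in M_p^+(D_{2^{-1/p}}) *)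
  (forall n : nat, cauchy_prod c d n = (n == 0%N)%:R) ->
  Mp p (2 `^ (- p^-1)) d ->
  forall x : R -> R[i], inLp p x -> cint x = 0 ->
  exists xd : nat -> R -> R[i],
    (forall D : nat, (1 <= D)%N ->
       inLp p (xd D) /\
       Lp_cvg p (fun N t => \sum_(1 <= n < N | bitcount n == D)
                              pairing x (gfun d n) * dil f n t) (xd D)) /\
    Lp_cvg p (fun M t => \sum_(1 <= D < M.+1) xd D t) x.
Proof.
move=> p1 Hf hf Hc cd Hd x hx x0; have p0 : 0 < p by exact: lt_trans p1.
have [Kc Kc0 HKc] := Mp_bounded p c p0 Hc.
have [Kd Kd0 HKd] := Mp_bounded p d p0 Hd.
have [Kt Kt0 HKt] := cellsym_bounded (R := R) p p0.
pose phi := cauchy_prod cellsym c; pose eta := dilconv d (node_diff x).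
have fphi i t : cell (2 ^ i) t -> f t = phi i by exact: first_order_value.
have Hphi b N : wsum p (cauchy_prod phi b) N <= Kt * Kc * wsum p b N.
  rewrite (eq_wsum _ _ (cauchy_prod cellsym (cauchy_prod c b))) => [|k _].
    by rewrite (le_trans (HKt _ _)) // -mulrA ler_wpM2l.
  by rewrite cauchy_prodA.
have fin_mass a K D : 0 <= K ->
    (forall b N, wsum p (cauchy_prod a b) N <= K * wsum p b N) ->
    (chaos_mass p D.+1 (dilconv a (node_diff x)) < +oo)%E.
  move=> K0 HK; apply: le_lt_trans (chaos_mass_dilconv p D a _ K K0 HK) _.
  have := chaos_mass_diff_fin p x D p1 hx.
  rewrite -ge0_fin_numE ?chaos_mass_ge0 // => /fineK <-.
  by rewrite -EFinM ltry.
(* The series of order D sums to [dilconv phi eta] at the stem; since phi is [cellsym] times c, eta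
   is d applied to the Haar coefficients and c d = 1, [dilconv_cancel] leaves this expression. *)
exists (fun D t => dilconv cellsym (node_diff x) (stem D t)); split=> [[//|D] _|].
  split.
    apply: (inLp_stem p D.+1 (dilconv cellsym (node_diff x))).
    by apply: le_lt_trans (Lpint_stem_mass _ _ _) _; exact: (fin_mass _ Kt).
  have := chaos_component_cvg p D f phi eta (Kt * Kc) p0 fphi
    (mulr_ge0 Kt0 Kc0) Hphi (fin_mass _ Kd D Kd0 HKd).
  rewrite /Lp_cvg; apply: cvg_trans; apply: near_eq_cvg; apply: nearW => N.
  apply: eq_Lpint => t t01; rewrite /phi dilconv_cancel ?stem_gt0 //.
  congr (cpow p (_ - _)); rewrite big_nat_cond [RHS]big_nat_cond.
  apply: eq_bigr => n /andP[/andP[n1 _] _].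
  by rewrite /eta -(pairing_gfun p) // ltW.
apply: eq_Lp_cvg (Lp_cvg_node_avg p x p1 hx) => M t t01.
rewrite (chaos_sum_telescope (node_avg x)) //; last first.
  by move=> n n0; exact: (node_avg_split p x n (ltW p1) hx n0).
by rewrite node_avg1 x0 subr0.
Qed.
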